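(* Let $\mathbb{F}$ be a free group (not necessarily finitely generated), let $\psi\in\mathrm{Aut}(\mathbb{F})$ and let $G=\mathbb{F}\rtimes_\psi\mathbb{Z}$. Then $G$ is finitely generated if and only if there is a free product decomposition \[ \mathbb{F}=A*\Big(\mathop{\ast}_{i\in\mathbb{Z}}C_i\Big) \] where $A$ and $C_0$ are finitely generated subgroups and $C_i=\psi^i(C_0)$ for all $i\in\mathbb{Z}$.
   Context: $\mathbb{F}\rtimes_\psi\mathbb{Z}=\langle \mathbb{F},t\mid t^{-1}ft=\psi(f)\ (f\in\mathbb{F})\rangle$. *)

(* Defs.v *)
From Stdlib Require Import ZArith List.
Import ListNotations.

Record group := Group {
  carrier :> Type;
  gmul : carrier -> carrier -> carrier;
  ginv : carrier -> carrier;
  gone : carrier;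
  gmulA : forall x y z, gmul x (gmul y z) = gmul (gmul x y) z;
  gmul1l : forall x, gmul gone x = x;
  gmulVl : forall x, gmul (ginv x) x = gone
}.

Inductive gen {T : Type} (mul : T -> T -> T) (inv : T -> T) (one : T)
    (S : T -> Prop) : T -> Prop :=
  | gen_base x : S x -> gen mul inv one S x
  | gen_one : gen mul inv one S one
  | gen_mul x y : gen mul inv one S x -> gen mul inv one S y ->
                  gen mul inv one S (mul x y)
  | gen_inv x : gen mul inv one S x -> gen mul inv one S (inv x).

Definition ggen (G : group) (S : G -> Prop) : G -> Prop :=
  gen (@gmul G) (@ginv G) (@gone G) S.

Definition is_subgroup (G : group) (H : G -> Prop) : Prop :=
  H (gone G) /\ (forall x y, H x -> H y -> H (gmul G x y)) /\
  (forall x, H x -> H (ginv G x)).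

Definition fg_subgroup (G : group) (H : G -> Prop) : Prop :=
  exists l : list G, forall x, H x <-> ggen G (fun y => In y l) x.

Definition gprod (G : group) (l : list G) : G :=
  fold_right (gmul G) (gone G) l.

Definition letter_val (G : group) (a : G * bool) : G :=
  if snd a then ginv G (fst a) else fst a.

Fixpoint reduced_word {T : Type} (w : list (T * bool)) : Prop :=
  match w with
  | [] => True
  | a :: w' =>
      match w' with
      | [] => True
      | b :: _ => ~ (fst a = fst b /\ snd a <> snd b)
      end /\ reduced_word w'
  end.

Definition free_basis (G : group) (S : G -> Prop) : Prop :=
  (forall x, ggen G S x) /\
  (forall w : list (G * bool),
      w <> [] -> Forall (fun a => S (fst a)) w -> reduced_word w ->
      gprod G (map (letter_val G) w) <> gone G).

Definition is_free_group (G : group) : Prop := exists S, free_basis G S.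

(* Internal free product decomposition G = *_{j : J} H j :
   the H j are subgroups, together they generate G, and every nonempty
   alternating product of nontrivial elements from factors with consecutive
   indices distinct is nontrivial (normal form theorem). *)
Fixpoint alternating {J T : Type} (l : list (J * T)) : Prop :=
  match l with
  | [] => True
  | a :: l' =>
      match l' with
      | [] => True
      | b :: _ => fst a <> fst b
      end /\ alternating l'
  end.

Definition free_product_decomp (G : group) (J : Type) (H : J -> G -> Prop)
  : Prop :=
  (forall j, is_subgroup G (H j)) /\
  (forall x, ggen G (fun y => exists j, H j y) x) /\
  (forall l : list (J * G),
      l <> [] -> Forall (fun a => H (fst a) (snd a) /\ snd a <> gone G) l ->
      alternating l -> gprod G (map snd l) <> gone G).

Definition is_hom (G : group) (f : G -> G) : Prop :=
  forall x y, f (gmul G x y) = gmul G (f x) (f y).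

Definition aut_pow {T : Type} (psi psiinv : T -> T) (z : Z) : T -> T :=
  match z with
  | Z0 => fun x => x
  | Zpos p => Nat.iter (Pos.to_nat p) psi
  | Zneg p => Nat.iter (Pos.to_nat p) psiinv
  end.

(* Semidirect product F x|_psi Z = < F, t | t^{-1} f t = psi f >.
   The pair (f, m) stands for f t^m; since t^m g = psi^{-m}(g) t^m:
     (f, m)(g, n) = (f psi^{-m}(g), m + n),  (f,m)^{-1} = (psi^m(f^{-1}), -m). *)
Definition sd_mul (F : group) (psi psiinv : F -> F) (a b : F * Z) : F * Z :=
  (gmul F (fst a) (aut_pow psi psiinv (- snd a) (fst b)), (snd a + snd b)%Z).

Definition sd_inv (F : group) (psi psiinv : F -> F) (a : F * Z) : F * Z :=
  (aut_pow psi psiinv (snd a) (ginv F (fst a)), (- snd a)%Z).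

Definition sd_one (F : group) : F * Z := (gone F, 0%Z).

Definition semidirect_fg (F : group) (psi psiinv : F -> F) : Prop :=
  exists l : list (F * Z),
    forall g, gen (sd_mul F psi psiinv) (sd_inv F psi psiinv) (sd_one F)
                  (fun y => In y l) g.

Definition img {T : Type} (f : T -> T) (H : T -> Prop) : T -> Prop :=
  fun x => exists y, H y /\ x = f y.

(* Main.v *)
Require Import Defs.
From Stdlib Require Import ZArith List Classical ClassicalEpsilon.
From Stdlib Require FinFun.
From mathcomp Require Import all_boot all_order all_algebra.
From mathcomp Require Import zify.

(** If X is a finite set whose psi-translates generate F, let V be generated by the
    psi^i X with i >= 0. The key point is that V is free on a finite set b together
    with all psi^i c, for some finite c. All freeness is tested on homomorphisms to
    the rationals: elements on which such homomorphisms take arbitrary prescribed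
    values are freely independent in a free group (a Magnus-type argument with
    unipotent representations). By Noetherianity of Q[t], the relations between the
    psi^i X are controlled, at the level of exponents, by those of degree at most n.
    One then takes subgroups P <= Q with psi P <= Q, P containing the psi^i X for
    i <= n, saturated so that a finite subtree of the Cayley graph of F injects modulo
    P into the graph of Q; a basis b of P extends to a basis b, c of Q. Characters
    prescribed on b and the psi^i c define compatible characters of Q which kill the
    relations of degree at most n, hence all relations, hence glue to V.

    Applied to psi on V, and then to psi^-1 on the complement E of the psi^i c
    (i >= 0) in F, this gives a basis of F made of a finite set b', the psi^-i d and
    the psi^i c (i >= 0). A rank count gives |c| = |d|, and the elements c_j d_j
    generate C_0, with A generated by b' and d. *)

Set Implicit Arguments. Unset Strict Implicit. Unset Printing Implicit Defensive.
Import GRing.Theory.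
Local Open Scope ring_scope.

Local Notation "x ** y" := (gmul _ x y) (at level 40, left associativity).
Local Notation inv := (ginv _).
Local Notation one := (gone _).

(** * Groups, words and rational characters *)

Lemma fun_choice (A B : Type) (R : A -> B -> Prop) :
  (forall x, exists y, R x y) -> exists f, forall x, R x (f x).
Proof.
move=> H; exists (fun x => proj1_sig (constructive_indefinite_description _ (H x))).
by move=> x; case: constructive_indefinite_description.
Qed.

Section Group.
Variable F : group.
Implicit Types (x y g h : F) (H S : F -> Prop).

Lemma gmulK x y : inv x ** (x ** y) = y.
Proof. by rewrite gmulA gmulVl gmul1l. Qed.

Lemma gmul_inj x y z : x ** y = x ** z -> y = z.
Proof. by move=> E; rewrite -(gmulK x y) E gmulK. Qed.

Lemma gmul1r x : x ** one = x.
Proof. by apply: (@gmul_inj (inv x)); rewrite gmulA gmulVl gmul1l. Qed.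

Lemma gmulVr x : x ** inv x = one.
Proof. by apply: (@gmul_inj (inv x)); rewrite gmulA gmulVl gmul1l gmul1r. Qed.

Lemma gmulKV x y : x ** (inv x ** y) = y.
Proof. by rewrite gmulA gmulVr gmul1l. Qed.

Lemma gmulrK x y : y ** x ** inv x = y.
Proof. by rewrite -gmulA gmulVr gmul1r. Qed.

Lemma gmulrKV x y : y ** inv x ** x = y.
Proof. by rewrite -gmulA gmulVl gmul1r. Qed.

Lemma ginv_eq x y : x ** y = one -> inv x = y.
Proof. by move=> E; apply: (@gmul_inj x); rewrite gmulVr. Qed.

Lemma ginvK x : inv (inv x) = x.
Proof. by apply: ginv_eq; rewrite gmulVl. Qed.

Lemma ginvM x y : inv (x ** y) = inv y ** inv x.
Proof. by apply: ginv_eq; rewrite gmulA gmulrK gmulVr. Qed.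

Lemma ginv1 : inv one = one :> F.
Proof. by apply: ginv_eq; rewrite gmul1l. Qed.

Lemma ggen_subgroup S : is_subgroup F (ggen F S).
Proof. by split; [exact: gen_one|split; [exact: gen_mul|exact: gen_inv]]. Qed.

Lemma ggen_sub S H : is_subgroup F H -> (forall x, S x -> H x) ->
  forall x, ggen F S x -> H x.
Proof.
by move=> [H1 [HM HV]] SH x; elim=> [{}x /SH||{}x y _ Hx _ Hy|{}x _ Hx]; auto.
Qed.

Lemma ggen_mono S S' : (forall x, S x -> S' x) -> forall x, ggen F S x -> ggen F S' x.
Proof. by move=> h; apply: ggen_sub (ggen_subgroup _) _ => x /h; exact: gen_base. Qed.

Lemma subgroup_mull H x y : is_subgroup F H -> H x -> H (x ** y) -> H y.
Proof. by move=> [_ [HM HV]] hx hxy; rewrite -(gmulK x y); apply: HM => //; apply: HV. Qed.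

Lemma subgroup_mulr H x y : is_subgroup F H -> H y -> H (x ** y) -> H x.
Proof. by move=> [_ [HM HV]] hx hxy; rewrite -(gmulrK y x); apply: HM => //; apply: HV. Qed.

(** A rational character of the subgroup [H], encoded as a total function on [F] whose values off
    [H] are left free. *)
Definition hom_on H (chi : F -> rat) : Prop :=
  forall x y, H x -> H y -> chi (x ** y) = chi x + chi y.

Lemma hom_on_sub H H' chi : (forall x, H x -> H' x) -> hom_on H' chi -> hom_on H chi.
Proof. by move=> s h x y /s hx /s hy; apply: h. Qed.

Lemma hom_on1 H chi : is_subgroup F H -> hom_on H chi -> chi one = 0.
Proof.
move=> [H1 _] h; have := h _ _ H1 H1; rewrite gmul1l => E.
by apply: (addIr (chi one)); rewrite add0r -E.
Qed.

Lemma hom_onV H chi x : is_subgroup F H -> hom_on H chi -> H x -> chi (inv x) = - chi x.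
Proof.
move=> sH h hx; have := h _ _ (proj2 (proj2 sH) _ hx) hx.
by rewrite gmulVl (hom_on1 sH h) => /esym /eqP; rewrite addr_eq0 => /eqP.
Qed.

Lemma hom_on_ext S chi chi' : hom_on (ggen F S) chi -> hom_on (ggen F S) chi' ->
  (forall x, S x -> chi x = chi' x) -> forall x, ggen F S x -> chi x = chi' x.
Proof.
move=> h h' E x; elim=> [{}x /E||{}x y gx Ex gy Ey|{}x gx Ex] //.
- by rewrite (hom_on1 (ggen_subgroup _) h) (hom_on1 (ggen_subgroup _) h').
- by rewrite h // h' // Ex Ey.
- by rewrite (hom_onV (ggen_subgroup _) h) // (hom_onV (ggen_subgroup _) h') // Ex.
Qed.

(** * Words, exponent sums and characters given on generators *)

Section Words.
Variables (I : Type) (z : I -> F).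

Fixpoint wval (w : seq (I * bool)) : F :=
  if w is a :: w' then (if a.2 then inv (z a.1) else z a.1) ** wval w' else one.

Lemma wval_cat w1 w2 : wval (w1 ++ w2) = wval w1 ** wval w2.
Proof. by elim: w1 => [|a w IH] /=; rewrite ?gmul1l // IH gmulA. Qed.

Fixpoint winv (w : seq (I * bool)) : seq (I * bool) :=
  if w is a :: w' then winv w' ++ [:: (a.1, ~~ a.2)] else [::].

Lemma wval_inv w : wval (winv w) = inv (wval w).
Proof.
elim: w => [|[i e] w IH] /=; first by rewrite ginv1.
by rewrite wval_cat IH /= gmul1r ginvM; case: e; rewrite ?ginvK.
Qed.

Definition letters_in (P : I -> Prop) (w : seq (I * bool)) :=
  forall a, In a w -> P a.1.

Lemma letters_in_cat P w1 w2 : letters_in P (w1 ++ w2) <-> letters_in P w1 /\ letters_in P w2.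
Proof.
split=> [h|[h1 h2] a /in_app_iff[]]; [|exact: h1|exact: h2].
by split=> a ha; apply: h; apply/in_app_iff; [left|right].
Qed.

Lemma letters_in_inv P w : letters_in P w -> letters_in P (winv w).
Proof.
elim: w => [|a w IH] //= h a' /in_app_iff[/IH|[<- /=|//]].
- by apply=> b hb; apply: h; right.
- by apply: h; left.
Qed.

Lemma ggen_word (P : I -> Prop) x :
  ggen F (fun y => exists i, P i /\ y = z i) x <->
  exists w, letters_in P w /\ wval w = x.
Proof.
split.
- elim=> [{}x [i [Pi ->]]||{}x y _ [w1 [h1 <-]] _ [w2 [h2 <-]]|{}x _ [w [h <-]]].
  + by exists [:: (i, false)]; split=> [a [<-|]|] //=; rewrite gmul1r.
  + by exists [::]; split=> // a.
  + by exists (w1 ++ w2); rewrite wval_cat; split=> //; apply/letters_in_cat.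
  + by exists (winv w); rewrite wval_inv; split=> //; apply: letters_in_inv.
- case=> w [h <-] {x}; elim: w h => [|[i e] w IH] h /=; first exact: gen_one.
  apply: gen_mul; last by apply: IH => a ha; apply: h; right.
  have Pi : P i by apply: (h (i, e)); left.
  by case: e {h} => /=; [apply: gen_inv|]; apply: gen_base; exists i.
Qed.

Fixpoint wsum (l : I -> rat) (w : seq (I * bool)) : rat :=
  if w is a :: w' then (if a.2 then - l a.1 else l a.1) + wsum l w' else 0.

Lemma wsum_cat l w1 w2 : wsum l (w1 ++ w2) = wsum l w1 + wsum l w2.
Proof. by elim: w1 => [|a w IH] /=; rewrite ?add0r // IH addrA. Qed.

Lemma wsum_inv l w : wsum l (winv w) = - wsum l w.
Proof.
elim: w => [|[i e] w IH] /=; first by rewrite oppr0.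
by rewrite wsum_cat IH /= addr0 opprD addrC; case: e; rewrite ?opprK.
Qed.

Lemma wsum_hom P chi (l : I -> rat) w :
  hom_on (ggen F (fun y => exists i, P i /\ y = z i)) chi ->
  letters_in P w -> (forall i, P i -> chi (z i) = l i) ->
  chi (wval w) = wsum l w.
Proof.
move=> h hw hl; have sG := ggen_subgroup (fun y => exists i, P i /\ y = z i).
elim: w hw => [|[i e] w IH] hw /=; first exact: hom_on1 h.
have Pi : P i by apply: (hw (i, e)); left.
have hw' : letters_in P w by move=> a ha; apply: hw; right.
have zi : ggen F (fun y => exists i, P i /\ y = z i) (z i) by apply: gen_base; exists i.
rewrite h ?IH //; first by case: e {hw}; rewrite ?(hom_onV sG h) // hl.
- by case: e {hw}; [apply: gen_inv|].
- by apply/ggen_word; exists w.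
Qed.

(** Two words with the same value differ by a relation, on which the exponent sum weighted by [l]
    vanishes; so this sum depends only on the value of the word. *)
Lemma hom_of_relations (P : I -> Prop) (l : I -> rat) :
  (forall w, letters_in P w -> wval w = one -> wsum l w = 0) ->
  exists chi, hom_on (ggen F (fun y => exists i, P i /\ y = z i)) chi /\
    forall i, P i -> chi (z i) = l i.
Proof.
move=> hrel.
have same w1 w2 : letters_in P w1 -> letters_in P w2 -> wval w1 = wval w2 ->
    wsum l w1 = wsum l w2.
  move=> h1 h2 E; apply/eqP; rewrite -subr_eq0 -wsum_inv -wsum_cat; apply/eqP.
  apply: hrel; last by rewrite wval_cat wval_inv E gmulVr.
  by apply/letters_in_cat; split=> //; apply: letters_in_inv.
(* Off the generated subgroup nothing is required, and 0 is the default. *)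
have ex x : exists r, forall w, letters_in P w -> wval w = x -> r = wsum l w.
  case: (classic (exists w, letters_in P w /\ wval w = x)) => [[w [h <-]]|n].
    by exists (wsum l w) => w' h' E; apply: same.
  by exists 0 => w h E; case: n; exists w.
have [chi hchi] := fun_choice ex; exists chi; split.
- move=> x y /ggen_word[w1 [h1 E1]] /ggen_word[w2 [h2 E2]].
  rewrite (hchi x w1) // (hchi y w2) // (hchi _ (w1 ++ w2)) ?wsum_cat //.
    by apply/letters_in_cat.
  by rewrite wval_cat E1 E2.
- move=> i Pi; rewrite (hchi _ [:: (i, false)]) /= ?gmul1r ?addr0 //.
  by move=> a [<-|].
Qed.

End Words.
End Group.

Lemma not_reduced_split (T : Type) (w : seq (T * bool)) :
  ~ reduced_word w -> exists u x e v, w = u ++ (x, e) :: (x, ~~ e) :: v.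
Proof.
elim: w => [|[x e] w IH] /=; first by case.
case: (classic (reduced_word w)) => [rw|/IH[u [x' [e' [v ->]]]]]; last first.
  by move=> _; exists ((x, e) :: u), x', e', v.
case: w {IH} rw => [|[y e'] w] rw n; first by case: n.
exists nil, x, e, w => /=.
have [<- ne] : x = y /\ e <> e' by apply: NNPP => h; apply: n; split.
by congr (_ :: (_, _) :: _); case: e e' ne {n rw} => [] [].
Qed.

(** * Integration of edge functions over the Cayley tree of a free group *)

Section Integration.
Variables (F : group) (S : F -> Prop) (V : zmodType).
Hypothesis SF : free_basis F S.
Variable phi : F -> F -> V.

(** The edge from [h] to [h ** s] carries [phi h s]; an inverse letter runs backwards along the edge
    that starts at [g ** inv s]. *)
Fixpoint path_sum (g : F) (w : seq (F * bool)) : V :=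
  match w with
  | [::] => 0
  | (s, false) :: w' => phi g s + path_sum (g ** s) w'
  | (s, true) :: w' => - phi (g ** inv s) s + path_sum (g ** inv s) w'
  end.

Lemma path_sum_cat g w1 w2 :
  path_sum g (w1 ++ w2) = path_sum g w1 + path_sum (g ** wval id w1) w2.
Proof.
elim: w1 g => [|[s e] w IH] g /=; first by rewrite add0r gmul1r.
by case: e; rewrite IH addrA gmulA.
Qed.

Lemma path_sum_inv g w : path_sum (g ** wval id w) (winv w) = - path_sum g w.
Proof.
elim: w g => [|[s e] w IH] g /=; first by rewrite oppr0.
rewrite path_sum_cat wval_inv gmulA IH gmulrK.
by case: e => /=; rewrite ?gmulrK addr0 opprD ?opprK addrC.
Qed.

(** Induction on the length: a nonempty closed word is not reduced, [S] being a free basis, and a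
    cancelling pair of letters traverses one edge in both directions. *)
Lemma path_sum_loop w : letters_in S w -> wval id w = one -> forall g, path_sum g w = 0.
Proof.
have [k] := ubnP (size w); elim: k w => // k IH w wk hS hv g.
case: (classic (w = [::])) => [-> //|w0].
have nr : ~ reduced_word w.
  move=> rw; apply: (proj2 SF w w0 _ rw).
    by apply/Forall_forall => a /hS.
  rewrite -hv; elim: {wk hS hv w0 rw} w => [|a w IHw] //=.
  by rewrite -IHw.
have [u [x [e [v E]]]] := not_reduced_split nr; subst w.
have -> : path_sum g (u ++ (x, e) :: (x, ~~ e) :: v) = path_sum g (u ++ v).
  rewrite !path_sum_cat; congr (_ + _).
  by case: e {nr wk hS hv w0} => /=; rewrite ?gmulrK ?gmulrKV addrA ?subrr ?addNr add0r.
apply: IH.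
- by move: wk; rewrite !size_cat /=; lia.
- move: hS => /letters_in_cat[h1 h2]; apply/letters_in_cat; split=> // a ha.
  by apply: h2; right; right.
- rewrite -hv !wval_cat /=; congr (_ ** _).
  by case: e {nr wk hS hv w0} => /=; rewrite ?gmulK ?gmulKV.
Qed.

(* The Cayley graph of a free group with respect to a basis is a tree, so every
   function on its edges is a coboundary. *)
Lemma integrate : exists K : F -> V, K one = 0 /\
  forall g s, S s -> K (g ** s) = K g + phi g s.
Proof.
have ex g : exists w, letters_in S w /\ wval id w = g.
  apply/ggen_word; apply: ggen_mono (proj1 SF g) => x Sx; by exists x.
have [wd hw] := fun_choice ex.
have same w1 w2 : letters_in S w1 -> letters_in S w2 -> wval id w1 = wval id w2 ->
    path_sum one w1 = path_sum one w2.
  move=> h1 h2 E; apply/eqP; rewrite -subr_eq0; apply/eqP.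
  rewrite -(path_sum_inv one w2) gmul1l -E -[wval id w1]gmul1l -path_sum_cat.
  apply: path_sum_loop; last by rewrite wval_cat wval_inv E gmulVr.
  by apply/letters_in_cat; split=> //; apply: letters_in_inv.
exists (fun g => path_sum one (wd g)); split.
  by have [h1 h2] := hw one; rewrite (path_sum_loop h1 h2).
move=> g s Ss; have [h1 h2] := hw g; have [h3 h4] := hw (g ** s).
rewrite (same _ (wd g ++ [:: (s, false)])) //.
- by rewrite path_sum_cat h2 gmul1l /= addr0.
- by apply/letters_in_cat; split=> // a [<-|].
- by rewrite wval_cat h2 h4 /= gmul1r.
Qed.

Lemma eq_integral (K K' : F -> V) : K one = K' one ->
  (forall g s, S s -> K (g ** s) = K g + phi g s) ->
  (forall g s, S s -> K' (g ** s) = K' g + phi g s) -> forall g, K g = K' g.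
Proof.
move=> E hK hK' g.
(* The equivalence, rather than an implication, lets the induction pass to inverses. *)
suff h x : ggen F S x -> forall g, K g = K' g <-> K (g ** x) = K' (g ** x).
  by move/h: (proj1 SF g) => /(_ one); rewrite gmul1l => <-.
elim=> [{}x Sx g'||{}x y _ hx _ hy g'|{}x _ hx g'].
- by rewrite hK // hK' //; split=> [->|/addIr].
- by move=> g'; rewrite gmul1r.
- by rewrite gmulA -hy; apply: hx.
- by rewrite (hx (g' ** inv x)) gmulrKV.
Qed.

End Integration.

(** * Independence in the abelianization implies freeness *)

Definition total_hom (F : group) (chi : F -> rat) := hom_on (fun _ => True) chi.

Lemma total_hom1 (F : group) (chi : F -> rat) : total_hom chi -> chi one = 0.
Proof. exact: hom_on1. Qed.

Section Cyclic.
Variables (F : group) (x : F).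

Let pw (n : nat) : F := iter n (gmul F x) one.

Lemma pwD m n : pw m ** pw n = pw (m + n).
Proof. by elim: m => [|m IH] /=; rewrite ?gmul1l // -gmulA IH. Qed.

Lemma cyclic_normal_form g : ggen F (eq x) g -> exists m n, g = pw m ** inv (pw n).
Proof.
have cV m n : inv (pw n) ** pw m = pw m ** inv (pw n).
  apply: (@gmul_inj _ (pw n)); rewrite gmulKV gmulA pwD addnC -pwD.
  by rewrite gmulrK.
elim=> [_ <-||_ _ _ [m1 [n1 ->]] _ [m2 [n2 ->]]|_ _ [m [n ->]]].
- by exists 1%N, 0%N; rewrite /= ginv1 !gmul1r.
- by exists 0%N, 0%N; rewrite /= ginv1 !gmul1r.
- exists (m1 + m2)%N, (n2 + n1)%N; rewrite -gmulA (gmulA _ (inv (pw n1))) cV.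
  by rewrite -!pwD ginvM !gmulA.
- by exists n, m; rewrite ginvM ginvK.
Qed.

Lemma cyclic_hom_eq0 (chi : F -> rat) g :
  total_hom chi -> chi x = 1 -> ggen F (eq x) g -> chi g = 0 -> g = one.
Proof.
move=> hchi chix /cyclic_normal_form[m [n ->]].
have chipw k : chi (pw k) = k%:R.
  by elim: k => [|k IH] /=; rewrite ?total_hom1 // hchi // IH chix -mulrS.
rewrite hchi // (hom_onV _ hchi) // !chipw => /eqP; rewrite subr_eq0 Num.Theory.eqr_nat.
by move=> /eqP->; rewrite gmulVr.
Qed.
End Cyclic.

Section Independence.
Variables (F : group) (S : F -> Prop).
Hypothesis SF : free_basis F S.
Variables (I : Type) (z : I -> F) (J : I -> Prop).
Hypothesis prescribe : forall l : I -> rat,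
  exists chi, total_hom chi /\ forall i, J i -> chi (z i) = l i.

Section Modules.
Variables (n : nat) (rho : F -> 'M[rat]_n).

Definition representation := rho one = 1%:M /\ forall g h, rho (g ** h) = rho g *m rho h.

Definition cocycle (u : F -> 'cV[rat]_n) := forall g h, u (g ** h) = u g + rho g *m u h.

(** The analogue of [prescribe] with coefficients in the module of [rho]; it is carried along as the
    dimension grows. *)
Definition prescribable := forall a : I -> 'cV[rat]_n,
  exists u, cocycle u /\ forall i, J i -> u (z i) = a i.
End Modules.

Lemma cocycle1 n (rho : F -> 'M[rat]_n) u : representation rho -> cocycle rho u -> u one = 0.
Proof.
move=> [r1 _] hu; have := hu one one; rewrite gmul1l r1 mul1mx => E.
by apply: (addIr (u one)); rewrite add0r -E.
Qed.

(** The extension of the trivial one-dimensional representation by [rho] with class [u]. *)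
Definition ext_rep n (rho : F -> 'M[rat]_n) (u : F -> 'cV[rat]_n) (g : F) : 'M[rat]_(n + 1) :=
  block_mx (rho g) (u g) 0 1%:M.

Lemma ext_repP n (rho : F -> 'M[rat]_n) u :
  representation rho -> cocycle rho u -> representation (ext_rep rho u).
Proof.
move=> hr hu; split=> [|g h]; rewrite /ext_rep.
  by rewrite (proj1 hr) (cocycle1 hr hu) -scalar_mx_block.
rewrite mulmx_block !mulmx0 !mul0mx !mulmx1 !addr0 add0r (proj2 hr) hu.
by rewrite addrC.
Qed.

(** A cocycle of the extension is a pair of a function [w] and a character [chi] with [w (g ** h) =
    w g + rho g *m w h + chi h *: u g]. On a free group a solution [K] is found by integration over
    the Cayley tree; a cocycle [v] of [rho] then corrects its values at the [z i]. *)
Lemma ext_prescribable n (rho : F -> 'M[rat]_n) u :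
  representation rho -> cocycle rho u -> prescribable rho -> prescribable (ext_rep rho u).
Proof.
move=> hr hu pr a.
have [chi [hchi chiz]] := prescribe (fun i => dsubmx (a i) 0 0).
have [K [K1 HK]] := integrate SF (fun g s => chi s *: u g).
have Kc g h : K (g ** h) = K g + rho g *m K h + chi h *: u g.
  move: h; apply: (eq_integral SF (phi := fun h s => chi s *: u (g ** h))).
  - by rewrite gmul1r K1 mulmx0 (total_hom1 hchi) scale0r !addr0.
  - by move=> h s Ss; rewrite gmulA HK.
  - move=> h s Ss; rewrite HK // hchi // hu mulmxDr -scalemxAr scalerDl scalerDr.
    by rewrite -!addrA; do 2 congr (_ + _); rewrite addrCA; congr (_ + _); rewrite addrC.
have [v [hv vz]] := pr (fun i => usubmx (a i) - K (z i)).
exists (fun g => col_mx (v g + K g) (chi g)%:M); split.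
- move=> g h; rewrite /ext_rep mul_block_col mul0mx mul1mx add0r add_col_mx.
  rewrite hchi // raddfD /= hv Kc mulmxDr; congr col_mx.
  rewrite mul_mx_scalar -!addrA; congr (_ + _).
  exact: addrCA.
- move=> i Ji; rewrite vz // subrK chiz // -[RHS]vsubmxK; congr col_mx.
  by apply/matrixP=> j k; rewrite !ord1 mxE eqxx mulr1n.
Qed.

(** The head of the list is the last factor, so [drop k] leaves an initial subproduct. *)
Fixpoint rprod (l : seq (I * F)) : F :=
  if l is a :: l' then rprod l' ** a.2 else one.

(* For an alternating list the invariant below is reached by adding one dimension
   per factor: [r rho(g) e] is then the coefficient of the longest monomial in the
   Magnus expansion, so it vanishes on shorter products and not on the whole one. *)
Definition detected (l : seq (I * F)) := exists n (rho : F -> 'M[rat]_n) (r : 'rV_n) (e : 'cV_n),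
  [/\ representation rho, prescribable rho,
      forall i, J i -> (if l is a :: _ then i <> a.1 else True) -> rho (z i) *m e = e,
      r *m rho (rprod l) *m e <> 0 &
      forall k, (0 < k <= size l)%N -> r *m rho (rprod (drop k l)) *m e = 0].

Lemma detected_nil : detected [::].
Proof.
exists 1%N, (fun=> 1%:M), 1%:M, 1%:M; split=> //.
- by split=> // g h; rewrite mulmx1.
- move=> a; have [chi [hchi chiz]] := prescribe (fun i => a i 0 0).
  exists (fun g => (chi g)%:M); split=> [g h|i Ji].
    by rewrite mul1mx hchi // raddfD.
  by rewrite chiz //; apply/matrixP=> j k; rewrite !ord1 mxE eqxx mulr1n.
- by move=> i _ _; rewrite mulmx1.
- by rewrite !mulmx1 => /matrixP /(_ 0 0); rewrite !mxE.
- by case.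
Qed.

Lemma fix_cyclic n (rho : F -> 'M[rat]_n) (e : 'cV_n) x g :
  representation rho -> rho x *m e = e -> ggen F (eq x) g -> rho g *m e = e.
Proof.
move=> hr hx; elim=> [_ <-||g1 g2 _ E1 _ E2|g' _ E] //.
- by rewrite (proj1 hr) mul1mx.
- by rewrite (proj2 hr) -mulmxA E2.
- by rewrite -{1}E mulmxA -(proj2 hr) gmulVl (proj1 hr) mul1mx.
Qed.

Lemma cocycleV n (rho : F -> 'M[rat]_n) u g :
  representation rho -> cocycle rho u -> u (inv g) = - (rho (inv g) *m u g).
Proof.
move=> hr hu; have := hu (inv g) g; rewrite gmulVl (cocycle1 hr hu) => /esym /eqP.
by rewrite addr_eq0 => /eqP.
Qed.

(** The extension is taken along the cocycle [u] with value [e] at [z i] and 0 at the other [z j];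
    the new row and column read off [r *m u x]. On the whole product this is [chi g] times the old
    nonzero coefficient, and [chi g] is nonzero because [chi] is injective on the cyclic group of
    [z i]. *)
Lemma detected_cons i g l :
  J i -> ggen F (eq (z i)) g -> g <> one -> alternating ((i, g) :: l) ->
  (forall a, In a l -> J a.1 /\ ggen F (eq (z a.1)) a.2) ->
  detected l -> detected ((i, g) :: l).
Proof.
move=> Ji gi g1 [hd _] hl [n [rho [r [e [hr pr fixe top low]]]]].
have rei : rho (z i) *m e = e.
  by apply: fixe => //; case: l hd {hl top low} => // a l.
pose dl (j : I) : rat := if excluded_middle_informative (j = i) then 1 else 0.
have [u [hu uz]] := pr (fun j => dl j *: e).
have [chi [hchi chiz]] := prescribe dl.
have ui h : ggen F (eq (z i)) h -> u h = chi h *: e.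
  elim=> [_ <-||h1 h2 g1' E1 _ E2|h' gh E].
  - by rewrite uz // chiz.
  - by rewrite (cocycle1 hr hu) (total_hom1 hchi) scale0r.
  - by rewrite hu hchi // E1 E2 -scalemxAr (fix_cyclic hr rei g1') scalerDl.
  - rewrite (cocycleV _ hr hu) E -scalemxAr (fix_cyclic hr rei (gen_inv _ _ _ _ _ gh)).
    by rewrite (hom_onV _ hchi) // scaleNr.
have u0 j h : J j -> j <> i -> ggen F (eq (z j)) h -> u h = 0.
  move=> Jj ji; elim=> [_ <-||h1 h2 _ E1 _ E2|h' _ E].
  - by rewrite uz // /dl; case: (excluded_middle_informative _) => [/ji|_] //=; rewrite scale0r.
  - exact: cocycle1 hr hu.
  - by rewrite hu E1 E2 mulmx0 addr0.
  - by rewrite (cocycleV _ hr hu) E mulmx0 oppr0.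
have uc j h : J j -> ggen F (eq (z j)) h -> exists c, u h = c *: e.
  move=> Jj gh; case: (classic (j = i)) => [E|ji]; first by exists (chi h); apply: ui; rewrite -E.
  by exists 0; rewrite (u0 j) ?scale0r.
(* Each further factor adds a multiple of [r *m rho (rprod (drop k.+1 l)) *m e], which vanishes by
   [low]. *)
have ru k : r *m u (rprod (drop k l)) = 0.
  have [m] := ubnP (size l - k); elim: m k => // m IH k mk.
  case: (ltnP k (size l)) => kl; last by rewrite drop_oversize //= (cocycle1 hr hu) mulmx0.
  have [a E] : exists a, drop k l = a :: drop k.+1 l.
    case E: (drop k l) => [|a s]; first by move: (size_drop k l); rewrite E /=; lia.
    by exists a; rewrite -add1n -drop_drop E /= drop0.
  have [Ja ga] : J a.1 /\ ggen F (eq (z a.1)) a.2.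
    by apply: hl; rewrite -(cat_take_drop k l) E; apply/in_app_iff; right; left.
  have [c Ec] := uc _ _ Ja ga.
  rewrite E /= hu mulmxDr IH; last by lia.
  by rewrite add0r Ec -!scalemxAr mulmxA low ?scaler0 //; lia.
have rE x : row_mx r (0 : 'M_1) *m ext_rep rho u x *m col_mx 0 1%:M = r *m u x.
  by rewrite /ext_rep mul_row_block mul0mx addr0 mul0mx addr0 mul_row_col mulmx0 mulmx1 add0r.
exists (n + 1)%N, (ext_rep rho u), (row_mx r 0), (col_mx 0 1%:M); split.
- exact: ext_repP.
- exact: ext_prescribable.
- move=> j Jj /= ji; rewrite /ext_rep mul_block_col !mulmx0 !mulmx1 !add0r.
  by rewrite (u0 j) //; apply: gen_base.
- rewrite rE /= hu mulmxDr; have := ru 0; rewrite drop0 => ->.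
  rewrite add0r ui // -!scalemxAr mulmxA => /eqP; rewrite scaler_eq0 => /orP[]/eqP // c0.
  apply: g1; apply: (cyclic_hom_eq0 hchi (x := z i)) => //.
  by rewrite chiz // /dl; case: (excluded_middle_informative _).
- by case=> // k _; rewrite rE /= ru.
Qed.

(* The section hypothesis says that the [z i] are linearly independent in the rational
   abelianization. *)
Lemma alternating_neq1 l : l <> [::] -> alternating l ->
  (forall a, In a l -> J a.1 /\ ggen F (eq (z a.1)) a.2 /\ a.2 <> one) ->
  gprod F (map snd l) <> one.
Proof.
move=> l0 hl ha.
pose l' := map (fun a => (a.1, inv a.2)) l.
have El : rprod l' = inv (gprod F (map snd l)).
  rewrite /l'; elim: (l) => [|a s IH] /=; first by rewrite ginv1.
  by rewrite IH -ginvM.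
have al' : alternating l'.
  rewrite /l'; elim: (l) hl => [|a [|b s] IH] //= [h1 h2].
  by split=> //; apply: IH.
have hl' a : In a l' -> J a.1 /\ ggen F (eq (z a.1)) a.2 /\ a.2 <> one.
  move=> /in_map_iff[b [<- /ha[/= h1 [h2 h3]]]]; split=> //; split; first exact: gen_inv.
  by move=> E; apply: h3; rewrite -(ginvK b.2) E ginv1.
have : detected l'.
  elim: (l') al' hl' => [|[i g] s IH] as' hs; first exact: detected_nil.
  have [Ji [gi g1]] := hs (i, g) (or_introl erefl).
  apply: detected_cons => //.
    by move=> a h; have [? []] := hs a (or_intror h).
  by apply: IH; [case: as'|move=> a h; apply: hs; right].
move=> [n [rho [r [e [hr _ _ top low]]]]] E; apply: top.
have := low (size l'); rewrite drop_size /= => h; rewrite El E ginv1; apply: h.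
by rewrite leqnn andbT /l'; case: (l) l0.
Qed.
End Independence.

(** * Finiteness from linear algebra *)

Section Noetherian.
Variable m : nat.
Local Notation vec := ('I_m -> {poly rat}).

(** The submodule generated by [W], with linear relations required pointwise, so that membership
    respects pointwise equality by construction. *)
Inductive pspan (W : vec -> Prop) : vec -> Prop :=
  | pspan0 v : (forall k, v k = 0) -> pspan W v
  | pspan_add p w v v' : W w -> pspan W v -> (forall k, v' k = p * w k + v k) -> pspan W v'.

Lemma pspan_lin W p v1 v2 v : pspan W v1 -> pspan W v2 ->
  (forall k, v k = p * v1 k + v2 k) -> pspan W v.
Proof.
move=> h1 h2; elim: h1 v => {v1} [v1 h0 v E|q w v v' Ww _ IH Ev' u Eu].
  elim: h2 v E => {v2} [v2 h2 v E|q w v2 v2' Ww _ IH E2 v E].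
    by apply: pspan0 => k; rewrite E h0 h2 mulr0 addr0.
  apply: (@pspan_add _ q w v2) => //; first by apply: IH => k; rewrite h0 mulr0 add0r.
  by move=> k; rewrite E h0 mulr0 add0r E2.
apply: (@pspan_add _ (p * q) w (fun k => p * v k + v2 k)) => //; first exact: IH.
by move=> k; rewrite Eu Ev' mulrDr mulrA addrA.
Qed.

Lemma pspan_base (W : vec -> Prop) w : W w -> pspan W w.
Proof.
move=> h; apply: (@pspan_add _ 1 w (fun=> 0)) => //; first exact: pspan0.
by move=> k; rewrite mul1r addr0.
Qed.

Lemma pspan_sub (W W' : vec -> Prop) v : (forall w, W w -> pspan W' w) -> pspan W v -> pspan W' v.
Proof.
move=> h; elim=> {v} [v|p w v v' /h hw _ hv E]; first exact: pspan0.
exact: pspan_lin hw hv E.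
Qed.

Lemma pspan_finite (W : vec -> Prop) v : pspan W v ->
  exists l, (forall w, In w l -> W w) /\ pspan (fun w => In w l) v.
Proof.
elim=> {v} [v h|p w v v' Ww _ [l [hl hv]] E].
  by exists [::]; split=> //; apply: pspan0.
exists (w :: l); split=> [u [<-|/hl]|] //.
apply: (@pspan_add _ p w v) => //; first by left.
by apply: pspan_sub hv => u hu; apply: pspan_base; right.
Qed.

Lemma least_nat (P : nat -> Prop) : (exists n, P n) ->
  exists n, P n /\ forall k, (k < n)%N -> ~ P k.
Proof.
case=> n; have [b] := ubnP n; elim: b n => // b IH n nb Pn.
case: (classic (exists k, (k < n)%N /\ P k)) => [[k [kn Pk]]|h].
  by apply: (IH k) => //; lia.
by exists n; split=> // k kn Pk; apply: h; exists k.
Qed.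

(* Coordinate by coordinate: the values at the next coordinate of the elements of the
   span that vanish at the previous ones form a principal ideal. *)
Lemma pspan_finitely_generated (R : vec -> Prop) d :
  exists l, (forall w, In w l -> R w) /\ forall v, pspan R v ->
    exists v', pspan (fun w => In w l) v' /\ forall k : 'I_m, (k < d)%N -> v k = v' k.
Proof.
elim: d => [|d [l [lR hl]]].
  by exists [::]; split=> // v _; exists (fun=> 0); split=> //; apply: pspan0.
case: (ltnP d m) => dm; last first.
  exists l; split=> // v /hl[v' [hv' E]]; exists v'; split=> // k _; apply: E.
  by have := ltn_ord k; lia.
pose ko := Ordinal dm.
pose low (u : vec) := pspan R u /\ forall k : 'I_m, (k < d)%N -> u k = 0.
have subl v v' : pspan R v -> pspan (fun w => In w l) v' ->
    (forall k : 'I_m, (k < d)%N -> v k = v' k) -> low (fun k => v k - v' k).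
  move=> hv hv' E; split=> [|k kd]; last by rewrite E // subrr.
  apply: (@pspan_lin _ (-1) v' v) => //; last by move=> k; rewrite mulN1r addrC.
  by apply: pspan_sub hv' => w /lR; apply: pspan_base.
have ko_eq (k : 'I_m) : (k < d.+1)%N -> ~~ (k < d)%N -> k = ko.
  by move=> h1 h2; apply: val_inj => /=; lia.
case: (classic (exists u, low u /\ u ko != 0)) => [hu|n]; last first.
  exists l; split=> // v hv; have [v' [hv' E]] := hl v hv; exists v'; split=> // k kd.
  case: (boolP (k < d)%N) => [/E //|h]; rewrite (ko_eq k kd h).
  apply/eqP; rewrite -subr_eq0; apply: contra_notT n => ne.
  by exists (fun k => v k - v' k); split=> //; apply: subl.
(* Among the nonzero values at the new coordinate [ko], that of [u] has least size; it generates the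
   ideal of these values. *)
have [s [[u [[uR ulow] [u0 us]]] smin]] : exists s, (exists u, low u /\ u ko != 0 /\ size (u ko) = s) /\
    forall s', (s' < s)%N -> ~ exists u, low u /\ u ko != 0 /\ size (u ko) = s'.
  by apply: least_nat; case: hu => u [h1 h2]; exists (size (u ko)), u.
have [lu [luR hlu]] := pspan_finite uR.
exists (l ++ lu); split=> [w /in_app_iff[/lR|/luR] //|v hv].
have [v' [hv' E]] := hl v hv.
have [tR tlow] := subl _ _ hv hv' E.
(* Euclidean division: a nonzero remainder would be a value at [ko] of smaller size than that of
   [u]. *)
pose q := (v ko - v' ko) %/ u ko.
have Er : (v ko - v' ko) - q * u ko = (v ko - v' ko) %% u ko.
  by rewrite /q; move: (v ko - v' ko) => t; rewrite {1}(divp_eq t (u ko)) addrAC subrr add0r.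
exists (fun k => q * u k + v' k); split.
  apply: (@pspan_lin _ q u v') => //.
    by apply: pspan_sub hlu => w hw; apply: pspan_base; apply/in_app_iff; right.
  by apply: pspan_sub hv' => w hw; apply: pspan_base; apply/in_app_iff; left.
move=> k kd; case: (boolP (k < d)%N) => [h|h]; first by rewrite ulow // mulr0 add0r E.
rewrite (ko_eq k kd h); apply/eqP; rewrite -subr_eq -subr_eq0 Er.
apply: contraT => ne; exfalso.
apply: (smin (size ((v ko - v' ko) %% u ko))); first by rewrite -us ltn_modp.
exists (fun k => (v k - v' k) - q * u k); rewrite Er; split; [split|split] => //.
- apply: (@pspan_lin _ (- q) u (fun k => v k - v' k)) => //.
  by move=> i; rewrite mulNr addrC.
- by move=> i id; rewrite tlow // ulow // mulr0 subr0.
Qed.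


(** The linear functional on polynomials with ['X^i] sent to [f i]; multiplication by ['X] is dual
    to the shift of [f]. *)
Definition pair_poly (f : nat -> rat) (p : {poly rat}) : rat := \sum_(i < size p) p`_i * f i.

Lemma pair_poly_widen f (p : {poly rat}) n : (size p <= n)%N -> pair_poly f p = \sum_(i < n) p`_i * f i.
Proof.
move=> h; rewrite /pair_poly (big_ord_widen n (fun i => p`_i * f i) h) big_mkcond /=.
apply: eq_bigr => i _; case: ifP => // /negbT; rewrite -leqNgt => hi.
by rewrite nth_default // mul0r.
Qed.

Lemma pair_polyD f p q : pair_poly f (p + q) = pair_poly f p + pair_poly f q.
Proof.
have h1 := leq_maxl (size p) (size q); have h2 := leq_maxr (size p) (size q).
rewrite (pair_poly_widen f (size_polyD p q)) (pair_poly_widen f h1) (pair_poly_widen f h2).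
by rewrite -big_split; apply: eq_bigr => i _; rewrite /= coefD mulrDl.
Qed.

Lemma pair_polyZ f c p : pair_poly f (c *: p) = c * pair_poly f p.
Proof.
rewrite (pair_poly_widen f (size_scale_leq c p)) mulr_sumr; apply: eq_bigr => i _.
by rewrite coefZ mulrA.
Qed.

Lemma pair_poly0 f : pair_poly f 0 = 0.
Proof. by rewrite -(scale0r (0 : {poly rat})) pair_polyZ mul0r. Qed.

Lemma pair_polyXn f p j : pair_poly f ('X^j * p) = pair_poly (fun i => f (j + i)%N) p.
Proof.
have h : (size ('X^j * p)%R <= j + size p)%N.
  by apply: leq_trans (size_polyMleq _ _) _; rewrite size_polyXn.
rewrite (pair_poly_widen f h) big_split_ord /= big1 ?add0r => [|i _].
  by apply: eq_bigr => i _; rewrite coefXnM ltnNge leq_addr /= addKn.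
by rewrite coefXnM /= ltn_ord mul0r.
Qed.

Lemma pair_poly_sum f (J : Type) (r : seq J) (G : J -> {poly rat}) :
  pair_poly f (\sum_(j <- r) G j) = \sum_(j <- r) pair_poly f (G j).
Proof.
by elim: r => [|j r IH]; rewrite ?big_nil ?pair_poly0 // !big_cons pair_polyD IH.
Qed.

Lemma pair_polyM f p q :
  pair_poly f (p * q) = \sum_(j < size p) p`_j * pair_poly (fun i => f (j + i)%N) q.
Proof.
rewrite -{1}(coefK p) poly_def mulr_suml pair_poly_sum; apply: eq_bigr => j _.
by rewrite -scalerAl pair_polyZ pair_polyXn.
Qed.

Definition pair_vec (f : nat -> 'I_m -> rat) (v : vec) : rat :=
  \sum_k pair_poly (fun i => f i k) (v k).

Lemma pair_vec_pspan (W : vec -> Prop) f v :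
  (forall w j, W w -> pair_vec (fun i => f (j + i)%N) w = 0) -> pspan W v -> pair_vec f v = 0.
Proof.
move=> h; elim=> {v} [v v0|p w v v' Ww _ IH E].
  by rewrite /pair_vec big1 // => k _; rewrite v0 pair_poly0.
rewrite /pair_vec; under eq_bigr => k _ do rewrite E pair_polyD pair_polyM.
rewrite big_split /= -/(pair_vec f v) IH addr0 exchange_big /= big1 // => j _.
by rewrite -mulr_sumr -/(pair_vec (fun i => f (j + i)%N) w) h // mulr0.
Qed.

Fixpoint expo (w : seq ((nat * 'I_m) * bool)) (k : 'I_m) : {poly rat} :=
  if w is a :: w' then
    (if a.1.2 == k then (if a.2 then - 'X^(a.1.1) else 'X^(a.1.1)) else 0) + expo w' k
  else 0.

Lemma pair_expo f w : pair_vec f (expo w) = wsum (fun i => f i.1 i.2) w.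
Proof.
elim: w => [|[[i k] e] w IH] /=.
  by rewrite /pair_vec big1 // => k _; rewrite pair_poly0.
rewrite /pair_vec; under eq_bigr => j _ do rewrite pair_polyD.
rewrite big_split /= -IH; congr (_ + _).
have pX j : pair_poly (fun i => f i j) 'X^i = f i j.
  rewrite -[X in pair_poly _ X]mulr1 pair_polyXn /pair_poly size_poly1 big_ord1.
  by rewrite coefC eqxx mul1r addn0.
rewrite (bigD1 k) //= eqxx big1 ?addr0 => [|j jk].
  by case: e; rewrite ?pX // -scaleN1r pair_polyZ pX mulN1r.
by rewrite eq_sym (negbTE jk) pair_poly0.
Qed.

(* The exponent vectors of a set of words over letters (i, k), read in rat[X]^m with
   (i, k) |-> X^i at k, span a finitely generated module. *)
Lemma relations_bounded (Rel : seq ((nat * 'I_m) * bool) -> Prop) : exists n,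
  forall f : nat -> 'I_m -> rat,
    (forall j w, Rel w -> letters_in (fun i => i.1 <= n)%N w ->
       wsum (fun i => f (j + i.1)%N i.2) w = 0) ->
    forall w, Rel w -> wsum (fun i => f i.1 i.2) w = 0.
Proof.
pose R v := exists w, Rel w /\ v = expo w.
have [l [lR hl]] := pspan_finitely_generated R m.
have wdeg (w : seq ((nat * 'I_m) * bool)) : exists n, letters_in (fun i => i.1 <= n)%N w.
  elim: w => [|a w [n hn]]; first by exists 0%N.
  exists (a.1.1 + n)%N => b [<-|/hn]; lia.
(* The bound [n] covers the letters of one word chosen for each of the finitely many generators. *)
have [n hn] : exists n, forall v, In v l -> exists w, [/\ Rel w, v = expo w &
    letters_in (fun i => i.1 <= n)%N w].
  elim: (l) lR => [|v s IH] sR; first by exists 0%N.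
  have [|n hn] := IH; first by move=> w hw; apply: sR; right.
  have [w [Rw Ew]] := sR v (or_introl erefl); have [n' hn'] := wdeg w.
  exists (n + n')%N => u [<-|/hn[w' [Rw' Ew' hw']]].
    by exists w; split=> // a /hn'; lia.
  by exists w'; split=> // a /hw'; lia.
exists n => f hf w Rw; rewrite -pair_expo.
have [|v' [hv' E]] := hl (expo w); first by apply: pspan_base; exists w.
have -> : pair_vec f (expo w) = pair_vec f v' by apply: eq_bigr => k _; rewrite E.
apply: pair_vec_pspan hv' => u j /hn[w' [Rw' -> hw']].
by rewrite pair_expo hf.
Qed.

End Noetherian.

Lemma NoDup_nth_inj (T : Type) (x0 : T) (s : seq T) i j : NoDup s ->
  (i < size s)%N -> (j < size s)%N -> nth x0 s i = nth x0 s j -> i = j.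
Proof.
have inn (r : seq T) k : (k < size r)%N -> In (nth x0 r k) r.
  by elim: r k => [|x r IH] [|k] //= h; [left|right; apply: IH].
move=> h; elim: h i j => {s} [|x s hx _ IH] [|i] [|j] //= hi hj.
- by move=> E; case: hx; rewrite E; apply: inn.
- by move=> E; case: hx; rewrite -E; apply: inn.
- by move=> E; congr _.+1; apply: IH.
Qed.

(** The value of a character at [y i] is a fixed linear combination of its values on [G]. Characters
    dual to the [y i] thus factor an identity matrix of size [size J] through dimension [size G]. *)
Lemma size_independent (F : group) (I : Type) (y : I -> F) (J : seq I) (G : seq F) :
  NoDup J -> (forall i, In i J -> ggen F (fun g => In g G) (y i)) ->
  (forall l : I -> rat, exists chi, hom_on (ggen F (fun g => In g G)) chi /\
     forall i, In i J -> chi (y i) = l i) ->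
  (size J <= size G)%N.
Proof.
move=> nd hG pr; case: J nd hG pr => [|x0 J0] //; set J := x0 :: J0 => nd hG pr.
have inn k : (k < size J)%N -> In (nth x0 J k) J.
  elim: (J) k => [|x r IH] [|k] //= h; [by left|by right; apply: IH].
have sG := ggen_subgroup (fun g => In g G).
have coord g : ggen F (fun g => In g G) g -> exists c : 'I_(size G) -> rat,
    forall chi, hom_on (ggen F (fun g => In g G)) chi ->
    chi g = \sum_k c k * chi (nth one G k).
  elim=> [x hx||x1 x2 g1 [c1 h1] g2 [c2 h2]|x gx [c h]].
  - have [k0 E] : exists k : 'I_(size G), nth one G k = x.
      elim: (G) hx => [|a r IH] //= [->|/IH[k <-]]; first by exists ord0.
      by exists (lift ord0 k).
    exists (fun k => (k == k0)%:R) => chi _.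
    rewrite (bigD1 k0) //= eqxx mul1r E big1 ?addr0 // => k /negbTE->.
    by rewrite mul0r.
  - exists (fun=> 0) => chi h; rewrite (hom_on1 sG h) big1 // => k _.
    by rewrite mul0r.
  - exists (fun k => c1 k + c2 k) => chi h; rewrite h // h1 // h2 // -big_split.
    by apply: eq_bigr => k _; rewrite /= mulrDl.
  - exists (fun k => - c k) => chi h'; rewrite (hom_onV sG h') // h // -sumrN.
    by apply: eq_bigr => k _; rewrite mulNr.
have /fun_choice[c hc] : forall i : 'I_(size J), exists c : 'I_(size G) -> rat,
    forall chi, hom_on (ggen F (fun g => In g G)) chi ->
    chi (y (nth x0 J i)) = \sum_k c k * chi (nth one G k).
  by move=> i; apply: coord; apply: hG; apply: inn.
have /fun_choice[u hu] : forall j : 'I_(size J), exists u : 'I_(size G) -> rat,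
    forall i : 'I_(size J), \sum_k c i k * u k = (i == j)%:R.
  move=> j; have [chi [h hl]] := pr (fun i =>
    if excluded_middle_informative (i = nth x0 J j) then 1 else 0).
  exists (fun k => chi (nth one G k)) => i; rewrite -hc // hl; last exact: inn.
  case: (excluded_middle_informative _) => [E|ne].
    have /eqP-> // : i = j by apply: val_inj; apply: NoDup_nth_inj nd _ _ E.
  by case: eqP => // ij; case: ne; rewrite ij.
apply: (@mulmx1_min rat _ _ (\matrix_(i, k) c i k) (\matrix_(k, j) u j k)).
apply/matrixP=> i j; rewrite !mxE -hu; apply: eq_bigr => k _.
by rewrite !mxE.
Qed.

(** * Finite subtrees of the Cayley graph *)

Lemma bounded_list (T : Type) (P : T -> Prop) (l : seq T) :
  (forall x, P x -> In x l) -> exists l', forall x, P x <-> In x l'.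
Proof.
suff [l' h] : exists l', forall x, In x l' <-> In x l /\ P x.
  by move=> hl; exists l' => x; rewrite h; split=> [Px|[]//]; split=> //; apply: hl.
elim: l => [|a l [l' IH]]; first by exists [::] => x; split=> // -[].
case: (classic (P a)) => Pa; [exists (a :: l')|exists l'] => x /=; rewrite IH.
- by split=> [[<-|[h1 h2]]|[[<-|h1] h2]]; tauto.
- by split=> [[h1 h2]|[[E|h1] h2]]; [tauto|case: Pa; rewrite E|tauto].
Qed.

Lemma bounded_bind (T U : Type) (l : seq T) (P : T -> U -> Prop) :
  (forall t, exists l', forall u, P t u -> In u l') ->
  exists l', forall u, (exists t, In t l /\ P t u) -> In u l'.
Proof.
move=> h; elim: l => [|a l [l' IH]]; first by exists [::] => u [t []].
have [l'' h''] := h a; exists (l'' ++ l') => u [t [/= [<-|tl] Pt]]; apply/in_app_iff.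
  by left; apply: h''.
by right; apply: IH; exists t.
Qed.

Section Trees.
Variables (F : group) (S : F -> Prop).
Hypothesis SF : free_basis F S.

(* A finite subtree of the Cayley graph containing the origin: every vertex is
   joined by an edge labelled in [T] to one that comes later in the list. *)
Inductive tree_list (T : F -> Prop) : seq F -> Prop :=
  | tree_one : tree_list T [:: one]
  | tree_cons g d s D : tree_list T D -> In d D -> T s -> g = d ** s \/ d = g ** s ->
      tree_list T (g :: D).

Lemma tree_list_one T D : tree_list T D -> In one D.
Proof. by elim=> [|g d s {}D _ h *]; [left|right]. Qed.

Lemma tree_list_mono (T T' : F -> Prop) D : (forall s, T s -> T' s) ->
  tree_list T D -> tree_list T' D.
Proof.
by move=> h; elim=> [|g d s {}D _ IH dD /h Ts gd]; [exact: tree_one|apply: (tree_cons IH dD Ts gd)].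
Qed.

Lemma tree_list_letters T D : tree_list T D ->
  exists l, (forall s, In s l -> T s) /\ tree_list (fun s => In s l) D.
Proof.
elim=> [|g d s {}D _ [l [lT hD]] dD Ts gd].
  by exists [::]; split=> //; apply: tree_one.
exists (s :: l); split=> [x [<-|/lT]|] //.
apply: (tree_cons (T := fun s' => In s' (s :: l)) _ dD _ gd); last by left.
by apply: tree_list_mono hD => x; right.
Qed.

Lemma tree_list_extend D (l : seq F) : tree_list S D ->
  exists E, tree_list S (E ++ D) /\ forall g, In g l -> In g (E ++ D).
Proof.
move=> hD.
have ext1 w : letters_in S w -> forall h D, tree_list S D -> In h D ->
    exists E, tree_list S (E ++ D) /\ In (h ** wval id w) (E ++ D).
  elim: w => [|[s e] w IH] hw h {hD}D hD hh; first by exists [::]; rewrite gmul1r.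
  have Ss : S s by apply: (hw (s, e)); left.
  pose h' := h ** (if e then inv s else s).
  have hD' : tree_list S (h' :: D).
    apply: (tree_cons hD hh Ss); rewrite /h'; case: (e); [right|left] => //.
    by rewrite gmulrKV.
  have [|E [hE hh']] := IH _ h' (h' :: D) hD' (or_introl erefl).
    by move=> a ha; apply: hw; right.
  by exists (E ++ [:: h']); rewrite -catA /= gmulA.
elim: l => [|g l [E [hE hl]]]; first by exists [::].
have /ggen_word[w [hw Ew]] : ggen F (fun y => exists i, S i /\ y = id i) g.
  by apply: ggen_mono (proj1 SF g) => x Sx; exists x.
have [E' [hE' hg]] := ext1 w hw one _ hE (tree_list_one hE).
exists (E' ++ E); rewrite -catA; split=> // x [<-|/hl hx].
  by rewrite -Ew -(gmul1l _ (wval id w)).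
by apply/in_app_iff; right.
Qed.

Definition covered (H : F -> Prop) (L : seq F) (g : F) :=
  exists h l, [/\ H h, In l L & g = h ** l].

(** Injectivity of [L] into the quotient of the Cayley graph by the left action of [H]. *)
Definition inequivalent (H : F -> Prop) (L : seq F) :=
  forall h l l', H h -> In l L -> In l' L -> l' = h ** l -> l' = l.

Section Transversal.
Variable H : F -> Prop.
Hypothesis sH : is_subgroup F H.

Lemma inequivalent_fixed L h l l' : inequivalent H L -> H h -> In l L -> In l' L ->
  l' = h ** l -> h = one.
Proof.
move=> iL Hh lL l'L E; have := iL _ _ _ Hh lL l'L E; rewrite E => El.
by rewrite -(gmulrK l h) El gmulVr.
Qed.

(** The tree [D] is traversed from the origin: if [g] is not covered and its neighbour [d] equals
    [h ** l], then [inv h ** g] is a neighbour of [l] and is added. The result lifts a spanning tree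
    of the images of [L] and [D] together. *)
Lemma tree_transversal T L D : tree_list T L -> inequivalent H L -> tree_list T D ->
  exists E, [/\ tree_list T (E ++ L), inequivalent H (E ++ L),
    forall d, In d D -> covered H (E ++ L) d &
    forall l, In l E -> covered H D l].
Proof.
move=> tL iL; have [H1 [HM HV]] := sH; elim=> [|g d s {}D tD [E [tE iE cov back]] dD Ts gd].
  exists [::]; split=> // d [<-|//]; exists one, one; split=> //.
    exact: tree_list_one tL.
  by rewrite gmul1l.
have wk l : covered H D l -> covered H (g :: D) l.
  by move=> [h [x [? ? ->]]]; exists h, x; split=> //; right.
case: (classic (covered H (E ++ L) g)) => [cg|ncg].
  by exists E; split=> [//|//|x [<-//|/cov//]|l /back/wk].
have [h [l [Hh lL Ed]]] := cov d dD.
pose x := inv h ** g.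
have gx : g = h ** x by rewrite /x gmulKV.
have hx : x = l ** s \/ l = x ** s.
  by rewrite /x; case: gd => [->|Eg]; [left|right]; rewrite ?Ed -?gmulA ?gmulK // -Eg Ed gmulK.
exists (x :: E); split.
- exact: (tree_cons tE lL Ts hx).
- move=> h' l1 l2 Hh' /= [<-|l1L] [<-|l2L] //.
  + move=> E2; case: ncg; exists (h ** inv h'), l2; split=> //; first by apply: HM => //; apply: HV.
    by rewrite gx E2 -gmulA gmulK.
  + move=> E2; case: ncg; exists (h ** h'), l1; split=> //; first exact: HM.
    by rewrite gx E2 gmulA.
  + by move=> E2; apply: iE E2.
- move=> y [<-|yD].
    by exists h, x; split=> //; left.
  by have [h' [l' [? ? ->]]] := cov y yD; exists h', l'; split=> //; right.
- move=> y [<-|/back/wk//]; exists (inv h), g; split=> //; [exact: HV|by left].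
Qed.

(** Schreier generators: the edge from [l] labelled [s] ends at [g ** l'], so [g] is its fundamental
    cycle in the quotient graph with respect to the tree [L]. Tree edges give [one] and are
    excluded. *)
Definition edge (Sl L : seq F) (g : F) := g <> one /\ H g /\
  exists l, In l L /\ exists s, In s Sl /\ exists l', In l' L /\ g = l ** s ** inv l'.

(** Along the path in [D] from the origin to [h ** l], each step changes the translate of [L] by a
    Schreier generator, by its inverse, or not at all. *)
Lemma edge_walk Sl L D : In one L -> inequivalent H L -> tree_list (fun s => In s Sl) D ->
  (forall d, In d D -> covered H L d) ->
  forall h l, H h -> In l L -> In (h ** l) D -> ggen F (edge Sl L) h.
Proof.
move=> L1 iL tD; have [H1 [HM HV]] := sH.
elim: tD => [|g d s {}D tD IH dD Ts gd] cov h l Hh lL.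
  move=> [E|//]; rewrite (inequivalent_fixed iL Hh lL L1 E); exact: gen_one.
have covD x : In x D -> covered H L x by move=> xD; apply: cov; right.
move=> [Eg|]; last exact: IH.
have [h' [l' [Hh' l'L Ed]]] := covD d dD.
have Gh' : ggen F (edge Sl L) h' by apply: (IH covD h' l') => //; rewrite -Ed.
have stepG k : (exists a b, [/\ In a L, In b L & k = a ** s ** inv b]) -> H k -> ggen F (edge Sl L) k.
  move=> [a [b [aL bL E]]] Hk; case: (classic (k = one)) => [->|k1]; first exact: gen_one.
  by apply: gen_base; split=> //; split=> //; exists a; split=> //; exists s; split=> //; exists b.
case: gd => E.
- rewrite -(gmulKV h' h); apply: gen_mul => //; apply: stepG; last by apply: HM => //; apply: HV.
  exists l', l; split=> //; apply: (@gmul_inj _ h'); rewrite gmulKV !gmulA -Ed -E Eg.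
  by rewrite gmulrK.
- suff : ggen F (edge Sl L) (h' ** inv (inv h ** h')) by rewrite ginvM ginvK gmulKV.
  apply: gen_mul => //; apply: gen_inv.
  apply: stepG; last by apply: HM => //; apply: HV.
  exists l, l'; split=> //; apply: (@gmul_inj _ h); rewrite gmulKV !gmulA -Eg -E Ed.
  by rewrite gmulrK.
Qed.
End Transversal.

Lemma edges_bounded H Sl L : exists l, forall g, edge H Sl L g <-> In g l.
Proof.
suff [l hl] : exists l, forall g, (exists x, In x L /\ exists s, In s Sl /\
    exists y, In y L /\ g = x ** s ** inv y) -> In g l.
  by apply: (@bounded_list _ _ l) => g [_ [_ /hl]].
do 3 apply: bounded_bind => ?; eexists [:: _] => g ->; by left.
Qed.

(** * Free factors from subgraphs of a quotient graph *)

Section Pair.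
Variables (P Q A : F -> Prop) (D B : seq F).
Hypotheses (sQ : is_subgroup F Q) (PQ : forall g, P g -> Q g).
Hypothesis genP : forall g, P g <-> ggen F A g.
Hypothesis genQ : forall g, Q g -> ggen F (fun x => A x \/ In x B) g.
Hypothesis BQ : forall g, In g B -> Q g.
Hypothesis tD : tree_list S D.
Hypothesis AD : forall a, A a -> exists d, In d D /\ In (a ** d) D.
Hypothesis sat : forall d q, In d D -> Q q -> In (q ** d) D -> P q.

(* Saturation makes the graph of [P] spanned by [D] a subgraph of the graph of [Q],
   so that [P] is a free factor of [Q]; [b] and [c] are the fundamental cycles of a
   spanning tree of the former extended to one of the latter. *)
Lemma pair_bases : exists b c : seq F,
  [/\ forall g, P g <-> ggen F (fun x => In x b) g,
      forall g, Q g <-> ggen F (fun x => In x b \/ In x c) g &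
      forall u v : F -> rat, exists chi, [/\ hom_on Q chi,
        forall x, In x b -> chi x = u x & forall x, In x c -> chi x = v x]].
Proof.
have sP : is_subgroup F P.
  have [h1 [hM hV]] := ggen_subgroup A.
  split; first by apply/genP.
  by split=> [x y /genP hx /genP hy|x /genP hx]; apply/genP; [apply: hM|apply: hV].
have [Q1 [QM QV]] := sQ; have [P1 [PM PV]] := sP.
have [L0 [tL0 iL0 cov0 back0]] : exists L0, [/\ tree_list S L0, inequivalent P L0,
    forall d, In d D -> covered P L0 d & forall l, In l L0 -> covered P D l].
  have [|E [h1 h2 h3 h4]] := tree_transversal sP (tree_one S) _ tD.
    by move=> h l l' _ [<-|//] [<-|//].
  exists (E ++ [:: one]); split=> // l /in_app_iff[/h4//|[<-|//]].
  by exists one, one; rewrite gmul1l; split=> //; apply: tree_list_one tD.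
(* Saturation enters here: [l] and [l'] have translates by [P] in [D], and an element of [Q]
   relating two vertices of [D] lies in [P]. *)
have iQL0 : inequivalent Q L0.
  move=> q l l' Qq lL l'L E; have [p [d [Pp dD Ed]]] := back0 l lL.
  have [p' [d' [Pp' d'D Ed']]] := back0 l' l'L.
  apply: (iL0 q) => //; apply: (subgroup_mulr sP Pp); apply: (subgroup_mull sP (PV _ Pp')).
  apply: (sat dD); first by apply: (QM); [apply/PQ/PV|apply: QM => //; apply: PQ].
  by rewrite -!gmulA -Ed -E Ed' gmulK.
have [E1 [tE1 BE1]] := tree_list_extend B tD.
have [E [tL1 iL1 cov1 _]] := tree_transversal sQ tL0 iQL0 tE1.
set L1 := E ++ L0 in tL1 iL1 cov1.
have L01 l : In l L0 -> In l L1 by move=> h; apply/in_app_iff; right.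
have [Sl0 [Sl0S tD0]] := tree_list_letters tD.
have [Sl1 [Sl1S tD1]] := tree_list_letters tE1.
pose Sl := Sl0 ++ Sl1.
have SlS s : In s Sl -> S s by move=> /in_app_iff[/Sl0S|/Sl1S].
have {}tD0 : tree_list (fun s => In s Sl) D.
  by apply: tree_list_mono tD0 => s h; apply/in_app_iff; left.
have {}tD1 : tree_list (fun s => In s Sl) (E1 ++ D).
  by apply: tree_list_mono tD1 => s h; apply/in_app_iff; right.
have [b hb] := edges_bounded P Sl L0.
(* This marks the edges of the graph of [P]; the remaining nontrivial edges of the graph of [Q] give
   [c]. *)
pose old l l' g := [/\ In l L0, In l' L0 & P g].
pose newedge g := g <> one /\ Q g /\ exists l, In l L1 /\ exists s, In s Sl /\
   exists l', In l' L1 /\ g = l ** s ** inv l' /\ ~ old l l' g.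
have [c hc] : exists c, forall g, newedge g <-> In g c.
  have [l hl] := edges_bounded Q Sl L1.
  apply: (@bounded_list _ _ l) => g [h1 [h2 [x [xL [s [sS [y [yL [Eg _]]]]]]]]].
  by apply/hl; split=> //; split=> //; exists x; split=> //; exists s; split=> //; exists y.
have Pb g : P g -> ggen F (fun x => In x b) g.
  move/genP; apply: ggen_sub; first exact: ggen_subgroup.
  move=> a Aa; have [d [dD adD]] := AD Aa.
  have [h [l [Ph lL Ed]]] := cov0 d dD.
  have walk := edge_walk sP (tree_list_one tL0) iL0 tD0 cov0.
  have W1 : ggen F (edge P Sl L0) h by apply: (walk h l) => //; rewrite -Ed.
  have W2 : ggen F (edge P Sl L0) (a ** h).
    apply: (walk _ l) => //; last by rewrite -gmulA -Ed.
    by apply: PM => //; apply/genP; apply: gen_base.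
  rewrite -(gmulrK h a); apply: gen_mul; last apply: gen_inv.
    by apply: ggen_mono W2 => x /hb.
  by apply: ggen_mono W1 => x /hb.
exists b, c; split.
- move=> g; split; first exact: Pb.
  by apply: ggen_sub => // x /hb[_ []].
- move=> g; split; last first.
    by apply: ggen_sub => // x [/hb[_ [/PQ//]]|/hc[_ []]].
  move/genQ; apply: ggen_sub; first exact: ggen_subgroup.
  move=> x [Ax|xB].
    apply: (ggen_mono (S := fun y => In y b)); first by left.
    by apply: Pb; apply/genP; apply: gen_base.
  have : ggen F (edge Q Sl L1) x.
    apply: (edge_walk sQ (tree_list_one tL1) iL1 tD1 cov1 (l := one)).
    + exact: BQ.
    + exact: tree_list_one tL1.
    + by rewrite gmul1r; apply: BE1.
  apply: ggen_mono => y [y1 [Qy [l [lL [s [sS [l' [l'L Ey]]]]]]]].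
  case: (classic (old l l' y)) => [[h1 h2 h3]|n]; [left; apply/hb|right; apply/hc].
    by split=> //; split=> //; exists l; split=> //; exists s; split=> //; exists l'.
  by split=> //; split=> //; exists l; split=> //; exists s; split=> //; exists l'.
- move=> u v.
  have /fun_choice[rep hrep] : forall g, exists l, covered Q L1 g ->
      In l L1 /\ exists q, Q q /\ g = q ** l.
    move=> g; case: (classic (covered Q L1 g)) => [[q [l [h1 h2 h3]]]|n]; last by exists one.
    by exists l => _; split=> //; exists q.
  have rep_eq q l : Q q -> In l L1 -> rep (q ** l) = l.
    move=> Qq lL; have [|rL [q' [Qq' E']]] := hrep (q ** l); first by exists q, l.
    apply: (iL1 (inv q' ** q)) => //; first by apply: QM => //; apply: QV.
    by apply: (@gmul_inj _ q'); rewrite -E' -gmulA gmulKV.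
  have covM q g : Q q -> (covered Q L1 (q ** g) <-> covered Q L1 g).
    move=> Qq; split=> -[h [l [Qh lL Eg]]].
      by exists (inv q ** h), l; split=> //; [apply: QM => //; apply: QV|rewrite -gmulA -Eg gmulK].
    by exists (q ** h), l; split=> //; [apply: QM|rewrite Eg gmulA].
  have repM q g : Q q -> covered Q L1 g -> rep (q ** g) = rep g.
    move=> Qq [h [l [Qh lL ->]]]; rewrite gmulA !rep_eq //; exact: QM.
  pose val l l' g : rat := if excluded_middle_informative (g = one) then 0 else
     if excluded_middle_informative (old l l' g) then u g else v g.
  (* The prescribed values are spread over the edges invariantly under [Q], with 0 outside the
     covered part. By this invariance the integral [K] is additive under left translation by [Q]. *)
  pose phi g s := if excluded_middle_informative (covered Q L1 g /\ covered Q L1 (g ** s))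
     then val (rep g) (rep (g ** s)) (rep g ** s ** inv (rep (g ** s))) else 0.
  have [K [K1 HK]] := integrate SF phi.
  have Kphi l l' s q : Q q -> In l L1 -> In l' L1 -> l ** s = q ** l' -> phi l s = val l l' q.
    move=> Qq lL l'L Els; rewrite /phi.
    case: (excluded_middle_informative _) => [?|[]] /=; last first.
      by split; [exists one, l|exists q, l']; rewrite ?gmul1l.
    have El : rep l = l by rewrite -{1}(gmul1l _ l) rep_eq.
    by rewrite El Els rep_eq // gmulrK.
  have KQ q g : Q q -> K (q ** g) = K q + K g.
    move=> Qq; move: g; apply: (eq_integral SF (phi := phi)).
    + by rewrite gmul1r K1 addr0.
    + move=> g s Ss; rewrite gmulA HK //; congr (_ + _); rewrite /phi -gmulA.
      case: (excluded_middle_informative _) => [[/(covM q _ Qq) c1 /(covM q _ Qq) c2]|n] /=.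
        by case: (excluded_middle_informative _) => [?|[]] //=; rewrite (repM _ _ Qq c1) (repM _ _ Qq c2).
      case: (excluded_middle_informative _) => [[c1 c2]|//] /=; case: n.
      by split; apply/(covM q _ Qq).
    + by move=> g s Ss; rewrite HK // addrA.
  (* The edges of the tree [L1] have trivial label, so [K] vanishes on its vertices; the value of
     [phi] on any other edge is then that of [K] at its label. *)
  have KL l : In l L1 -> K l = 0.
    suff h L : tree_list S L -> (forall x, In x L -> In x L1) -> forall x, In x L -> K x = 0.
      by move=> ?; apply: (h L1).
    elim=> [_ x [<-|]|g d s {}L tL IH dL0 Ts gd hL x [<-|lL]] //; last first.
      by apply: IH => // y yL; apply: hL; right.
    have dL : In d L1 by apply: hL; right.
    have gL : In g L1 by apply: hL; left.
    have Kd : K d = 0 by apply: IH => // y yL; apply: hL; right.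
    have val0 y y' : val y y' one = 0.
      by rewrite /val; case: (excluded_middle_informative _).
    case: gd => Eg.
      by rewrite Eg HK // Kd (Kphi d g s one) ?gmul1l ?val0 ?addr0.
    by rewrite -Kd Eg HK // (Kphi g d s one) ?gmul1l ?val0 ?addr0.
  have Kedge l s l' q : Q q -> In l L1 -> In s Sl -> In l' L1 -> q = l ** s ** inv l' ->
      K q = val l l' q.
    move=> Qq lL /SlS Ss l'L Eq.
    have Els : l ** s = q ** l' by rewrite Eq gmulrKV.
    have := HK l s Ss; rewrite Els (KQ _ _ Qq) (KL _ lL) (KL _ l'L) addr0 add0r => ->.
    exact: Kphi.
  exists K; split=> [x y Qx _|x /hb[x1 [Px [l [lL [s [sS [l' [l'L Ex]]]]]]]]|].
  + exact: KQ.
  + rewrite (Kedge l s l' x (PQ Px) (L01 _ lL) sS (L01 _ l'L) Ex).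
    rewrite /val; case: (excluded_middle_informative _) => //= ?.
    by case: (excluded_middle_informative _) => //= -[].
  + move=> x /hc[x1 [Qx [l [lL [s [sS [l' [l'L [Ex no]]]]]]]]].
    rewrite (Kedge l s l') // /val; case: (excluded_middle_informative _) => //= ?.
    by case: (excluded_middle_informative _).
Qed.
End Pair.
End Trees.

(** * Orbits under one endomorphism *)

Section Endomorphism.
Variables (F : group) (theta : F -> F).
Hypothesis hom : is_hom F theta.

Lemma hom1 : theta one = one.
Proof. by apply: (@gmul_inj _ (theta one)); rewrite -hom !gmul1r. Qed.

Lemma homV x : theta (inv x) = inv (theta x).
Proof. by symmetry; apply: ginv_eq; rewrite -hom gmulVr hom1. Qed.

Lemma iter_hom i : is_hom F (iter i theta).
Proof. by move=> x y; elim: i => [|i IH] //=; rewrite IH hom. Qed.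

Lemma ggen_image (S T : F -> Prop) : (forall x, S x -> ggen F T (theta x)) ->
  forall g, ggen F S g -> ggen F T (theta g).
Proof.
move=> h g; elim=> [x /h//||x y _ hx _ hy|x _ hx].
- by rewrite hom1; apply: gen_one.
- by rewrite hom; apply: gen_mul.
- by rewrite homV; apply: gen_inv.
Qed.

Definition orbit_gen (X : seq F) : F -> Prop :=
  ggen F (fun y => exists i x, In x X /\ y = iter i theta x).

Lemma orbit_gen_iter X i g : orbit_gen X g -> orbit_gen X (iter i theta g).
Proof.
elim: i => //= i IH /IH; apply: ggen_image => _ [j [x [xX ->]]].
by apply: gen_base; exists j.+1, x.
Qed.
End Endomorphism.

Section OneSided.
Variables (F : group) (S : F -> Prop).
Hypothesis SF : free_basis F S.
Variable theta : F -> F.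
Hypothesis hom : is_hom F theta.
Variable X : seq F.

Let xk (k : 'I_(size X)) : F := nth one X k.
Let z (i : nat * 'I_(size X)) : F := iter i.1 theta (xk i.2).

Lemma xk_In k : In (xk k) X.
Proof.
rewrite /xk; have := ltn_ord k; elim: (X) (nat_of_ord k) => [|x r IH] [|j] //= h.
  by left.
by right; apply: IH.
Qed.

Lemma In_xk x : In x X -> exists k, x = xk k.
Proof.
rewrite /xk; elim: (X) => [|a r IH] //= [<-|/IH[k ->]]; first by exists ord0.
by exists (lift ord0 k).
Qed.

Lemma orbit_gen_z g :
  orbit_gen theta X g <-> ggen F (fun y => exists i, True /\ y = z i) g.
Proof.
split; apply: ggen_mono.
  by move=> _ [i [x [/In_xk[k ->] ->]]]; exists (i, k).
by move=> _ [[i k] [_ ->]]; exists i, (xk k); split=> //; apply: xk_In.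
Qed.

(** * Saturated pairs of subgroups and gluing of their characters *)

Section Saturation.
Variables (n : nat) (D : seq F).
Hypothesis tD : tree_list S D.
Hypothesis zD : forall i, (i.1 <= n)%N -> In (z i) D.

Definition with_image (R : F -> Prop) (y : F) := R y \/ exists x, R x /\ y = theta x.

Definition difference (a : F) := exists d, In d D /\ In (a ** d) D.

(* The least subset [A] of the finite set of differences of [D] that contains the
   [z i] and all the differences that lie in <A, theta A>. *)
Definition saturation (a : F) := forall R : F -> Prop,
  (forall i, (i.1 <= n)%N -> R (z i)) ->
  (forall x, difference x -> ggen F (with_image R) x -> R x) -> R a.

Lemma with_image_mono (R R' : F -> Prop) : (forall x, R x -> R' x) ->
  forall x, with_image R x -> with_image R' x.
Proof. by move=> h x [/h|[y [/h hy ->]]]; [left|right; exists y]. Qed.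

Lemma saturation_base i : (i.1 <= n)%N -> saturation (z i).
Proof. by move=> hi R h _; apply: h. Qed.

Lemma saturation_step x : difference x -> ggen F (with_image saturation) x -> saturation x.
Proof.
move=> dx gx R h1 h2; apply: (h2) => //; apply: ggen_mono gx.
by apply: with_image_mono => y; apply.
Qed.

Lemma saturation_difference a : saturation a -> difference a.
Proof.
apply=> // i hi; exists one; split; first exact: tree_list_one tD.
by rewrite gmul1r; apply: zD.
Qed.

Lemma saturation_finite : exists l, forall a, saturation a <-> In a l.
Proof.
suff [l hl] : exists l, forall a, (exists d, In d D /\ exists d', In d' D /\ a = d' ** inv d) -> In a l.
  apply: (@bounded_list _ _ l) => a /saturation_difference[d [dD adD]].
  by apply: hl; exists d; split=> //; exists (a ** d); rewrite gmulrK.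
by do 2 apply: bounded_bind => ?; eexists [:: _] => a ->; left.
Qed.

Let P := ggen F saturation.
Let Q := ggen F (with_image saturation).

(** The closure clause of [saturation] supplies the hypothesis [sat] of [pair_bases]: an element of
    [Q] relating two vertices of [D] is a difference. *)
Lemma saturated_pair : exists b c : seq F,
  [/\ forall g, P g <-> ggen F (fun x => In x b) g,
      forall g, Q g <-> ggen F (fun x => In x b \/ In x c) g &
      forall u v : F -> rat, exists chi, [/\ hom_on Q chi,
        forall x, In x b -> chi x = u x & forall x, In x c -> chi x = v x]].
Proof.
have [l hl] := saturation_finite.
have PQ g : P g -> Q g by apply: ggen_mono => x; left.
apply: (@pair_bases F S SF P Q saturation D (map theta l)) => //.
- exact: ggen_subgroup.
- move=> g; apply: ggen_mono => x [|[y [/hl hy ->]]]; first by left.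
  by right; apply: in_map.
- move=> g /in_map_iff[x [<- /hl hx]]; apply: gen_base; right.
  by exists x.
- exact: saturation_difference.
- move=> d q dD Qq qD; apply: gen_base; apply: saturation_step => //.
  by exists d.
Qed.

Lemma saturated_image g : P g -> Q (theta g).
Proof. by apply: ggen_image hom _ _ _ _ => x hx; apply: gen_base; right; exists x. Qed.

Lemma saturated_orbit g : Q g -> orbit_gen theta X g.
Proof.
have V_image (R : F -> Prop) : (forall x, R x -> orbit_gen theta X x) ->
    forall x, ggen F (with_image R) x -> orbit_gen theta X x.
  move=> h; apply: ggen_sub; first exact: ggen_subgroup.
  by move=> x [/h|[y [/h hy ->]]] //; apply: (orbit_gen_iter hom 1 hy).
(* The minimality of [saturation] serves as an induction principle, with [orbit_gen theta X] as
   [R]. *)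
apply: (V_image) => a; apply=> [[i k] _|x _]; last exact: V_image.
by apply: gen_base; exists i, (xk k); split=> //; apply: xk_In.
Qed.

(* On words of degree at most [n] the function to be extended coincides with a
   character of [Q], so it kills the corresponding relations, hence all of them. *)
Lemma glue_characters (h : nat -> F -> rat) :
  (forall f : nat -> 'I_(size X) -> rat,
    (forall j w, wval z w = one -> letters_in (fun i => i.1 <= n)%N w ->
       wsum (fun i => f (j + i.1)%N i.2) w = 0) ->
    forall w, wval z w = one -> wsum (fun i => f i.1 i.2) w = 0) ->
  (forall i, hom_on Q (h i)) -> (forall i g, P g -> h i.+1 g = h i (theta g)) ->
  exists chi, hom_on (orbit_gen theta X) chi /\
    forall i q, Q q -> chi (iter i theta q) = h i q.
Proof.
move=> bounded hQ hP.
have sQ : is_subgroup F Q by apply: ggen_subgroup.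
have PQ g : P g -> Q g by apply: ggen_mono => x; left.
have Pz i : (i.1 <= n)%N -> P (z i) by move=> hi; apply: gen_base; apply: saturation_base.
(* Compatibility on [P] trades each application of [theta] for a shift of the index of [h]. *)
have hz i j k : (i <= n)%N -> h j (z (i, k)) = h (j + i)%N (xk k).
  elim: i j => [|i IH] j hi; first by rewrite addn0.
  by rewrite /z /= -hP ?(IH j.+1 (ltnW hi)) ?addSnnS //; apply: (Pz (i, k)); apply: ltnW.
have [chi [hchi chiz]] : exists chi, hom_on (ggen F (fun y => exists i, True /\ y = z i)) chi /\
    forall i, True -> chi (z i) = h i.1 (xk i.2).
  apply: hom_of_relations => w _; apply: (bounded (fun i k => h i (xk k))) => j w' Ew hw'.
  rewrite -(hom_on1 sQ (hQ j)) -Ew; symmetry.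
  apply: (wsum_hom (P := fun i => (i.1 <= n)%N)) => //.
    apply: hom_on_sub (hQ j); apply: ggen_sub => // _ [i [hi ->]].
    by apply: PQ; apply: Pz.
  by case=> i k hi; apply: hz.
exists chi; split; first by apply: hom_on_sub hchi => g /orbit_gen_z.
have {}hchi : hom_on (orbit_gen theta X) chi by apply: hom_on_sub hchi => g /orbit_gen_z.
have onQ (R : F -> Prop) : (forall x, R x -> saturation x /\ forall i, chi (iter i theta x) = h i x) ->
    forall q, ggen F (with_image R) q -> forall i, chi (iter i theta q) = h i q.
  move=> hR q hq i.
  have RQ x : ggen F (with_image R) x -> Q x.
    by apply: ggen_mono; apply: with_image_mono => y /hR[].
  apply: (@hom_on_ext _ _ (fun g => chi (iter i theta g)) (h i) _ _ _ _ hq).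
  - move=> x y /RQ/saturated_orbit hx /RQ/saturated_orbit hy.
    by rewrite (iter_hom hom) hchi //; apply: orbit_gen_iter.
  - exact: hom_on_sub (hQ i).
  - move=> x [/hR[_ ->] //|[y [/hR[sy hy] ->]]].
    by rewrite -iterSr hy hP //; apply: gen_base.
move=> i q hq; apply: (onQ saturation) => // a ha; split=> //.
(* Membership in [saturation] is kept in [R] because [onQ] needs it to apply [hP]; minimality then
   gives the property for [a]. *)
pose R x := saturation x /\ forall i, chi (iter i theta x) = h i x.
suff [] : R a by [].
apply: ha => [[j k] hj|x dx hx].
  split; first exact: saturation_base.
  by move=> i'; rewrite hz // -iterD (chiz (i' + j, k)%N).
split; last by apply: onQ hx => y.
by apply: saturation_step => //; apply: ggen_mono hx; apply: with_image_mono => y [].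
Qed.

End Saturation.

(** By the first three clauses [b] and the translates of [c] generate the orbit subgroup; by the
    last they are independent. *)
Lemma one_sided : exists b c : seq F,
  [/\ forall x, In x X -> ggen F (fun g => In g b) x,
      forall x, In x b -> ggen F (fun g => In g b \/ In g c) (theta x),
      forall x, In x b \/ In x c -> orbit_gen theta X x &
      forall (u : F -> rat) (v : nat -> F -> rat), exists chi,
        [/\ hom_on (orbit_gen theta X) chi, forall x, In x b -> chi x = u x &
            forall i x, In x c -> chi (iter i theta x) = v i x]].
Proof.
have [n hn] := relations_bounded (fun w => wval z w = one).
have [D [tD zD]] : exists D, tree_list S D /\ forall i, (i.1 <= n)%N -> In (z i) D.
  have [l hl] : exists l, forall y, (exists i, In i (iota 0 n.+1) /\ exists x, In x X /\
      y = iter i theta x) -> In y l.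
    by do 2 apply: bounded_bind => ?; eexists [:: _] => a ->; left.
  have [E [tE hE]] := tree_list_extend SF l (tree_one S).
  exists (E ++ [:: one]); split=> // -[i k] hi; apply: hE; apply: hl.
  exists i; split; last by exists (xk k); split=> //; apply: xk_In.
  have : i \in iota 0 n.+1 by rewrite mem_iota.
  elim: (iota _ _) => //= a r IH; rewrite inE => /orP[/eqP->|/IH]; first by left.
  by right.
have [b [c [hP hQ pr]]] := saturated_pair tD zD.
exists b, c; split.
- move=> x /In_xk[k ->]; apply/hP; apply: gen_base.
  exact: (@saturation_base n D (0%N, k)).
- move=> x xb; apply/hQ; apply: saturated_image; apply/hP; exact: gen_base.
- by move=> x xbc; apply: saturated_orbit; apply/hQ; apply: gen_base.
- move=> u v.
  have /fun_choice[ext hext] : forall uv : (F -> rat) * (F -> rat), exists chi : F -> rat,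
      [/\ hom_on (ggen F (with_image (saturation n D))) chi,
        forall x, In x b -> chi x = uv.1 x & forall x, In x c -> chi x = uv.2 x].
    by move=> uv; apply: pr.
  (* On [b], hence on [P], [h i.+1] agrees with [h i] composed with [theta], as gluing requires; on
     [c] it is free to take the values [v i.+1]. *)
  pose h := fix h i := if i is j.+1 then ext (fun x => h j (theta x), v i) else ext (u, v 0%N).
  have hh i : hom_on (ggen F (with_image (saturation n D))) (h i).
    by case: i => [|i]; [have [] := hext (u, v 0%N)|have [] := hext (fun x => h i (theta x), v i.+1)].
  have hc i x : In x c -> h i x = v i x.
    move=> xc; case: i => [|i]; first by have [_ _ /(_ x xc)] := hext (u, v 0%N).
    by have [_ _ /(_ x xc)] := hext (fun x => h i (theta x), v i.+1).
  have [|chi [hchi chiQ]] := glue_characters hn hh.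
    move=> i g /hP; apply: (@hom_on_ext _ _ (h i.+1) (fun g => h i (theta g))).
    + apply: hom_on_sub (hh i.+1) => x /hP; apply: ggen_mono => y; by left.
    + move=> x y /hP hx /hP hy; rewrite hom hh //; exact: saturated_image.
    + by move=> x xb; have [_ /(_ x xb)] := hext (fun x => h i (theta x), v i.+1).
  exists chi; split=> // [x xb|i x xc].
    rewrite (chiQ 0%N); last by apply/hQ; apply: gen_base; left.
    by have [_ /(_ x xb)] := hext (u, v 0%N).
  by rewrite chiQ ?hc //; apply/hQ; apply: gen_base; right.
Qed.
End OneSided.

(** * Both directions of an automorphism *)

Lemma NoDup_rank (T : Type) (x0 : T) (s : seq T) : NoDup s ->
  exists f, forall j, (j < size s)%N -> f (nth x0 s j) = j.
Proof.
move=> nd.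
have /fun_choice[f hf] : forall x, exists k, forall j, (j < size s)%N -> nth x0 s j = x -> k = j.
  move=> x; case: (classic (exists j, (j < size s)%N /\ nth x0 s j = x)) => [[j [js <-]]|n].
    by exists j => i si E; exact: NoDup_nth_inj nd js si (esym E).
  by exists 0%N => j js E; case: n; exists j.
by exists f => j js; apply: hf.
Qed.

Lemma In_nth (T : Type) (x0 : T) (s : seq T) x :
  In x s <-> exists j, (j < size s)%N /\ x = nth x0 s j.
Proof.
split; elim: s => [|a s IH] //=.
- by case=> [<-|/IH[j [js ->]]]; [exists 0%N|exists j.+1].
- by case=> j [].
- by case=> -[|j] [js Ex]; [left|right; apply: IH; exists j].
Qed.

Lemma NoDup_same (T : Type) (s : seq T) : exists s', NoDup s' /\ forall x, In x s' <-> In x s.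
Proof.
elim: s => [|a s [s' [nd hs]]]; first by exists [::]; split=> //; constructor.
case: (classic (In a s)) => h.
  by exists s'; split=> // x; rewrite hs /=; split; [right|case=> // <-].
exists (a :: s'); split; first by constructor => //; rewrite hs.
by move=> x /=; rewrite hs.
Qed.

Lemma In_iota i j k : In i (iota j k) <-> (j <= i < j + k)%N.
Proof. by elim: k j => [|k IH] j /=; rewrite ?IH; lia. Qed.

Definition grid (T : Type) (n : nat) (s : seq T) : seq (nat * T) :=
  flat_map (fun i => map (pair i) s) (iota 0 n).

Lemma In_grid (T : Type) n (s : seq T) i x : In (i, x) (grid n s) <-> (i < n)%N /\ In x s.
Proof.
rewrite in_flat_map; split.
  by case=> j [/In_iota jn /in_map_iff[y [[<- <-] ys]]].
by case=> i_n xs; exists i; split; [apply/In_iota|apply: in_map].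
Qed.

Lemma size_grid (T : Type) n (s : seq T) : size (grid n s) = (n * size s)%N.
Proof.
rewrite /grid; elim: n {1}0%N => //= n IH j.
by rewrite size_cat size_map IH mulSn.
Qed.

Lemma NoDup_grid (T : Type) n (s : seq T) : NoDup s -> NoDup (grid n s).
Proof.
move=> nd; rewrite /grid.
suff h j : NoDup (flat_map (fun i => map (pair i) s) (iota j n)) /\
   forall i x, In (i, x) (flat_map (fun i => map (pair i) s) (iota j n)) -> (j <= i)%N.
  by have [] := h 0%N.
elim: n j => [|n IH] j /=; first by split=> //; constructor.
have [h1 h2] := IH j.+1; split; last first.
  by move=> i x /in_app_iff[/in_map_iff[y [[<- _] _]] //|/h2/ltnW].
apply: NoDup_app => //.
  by apply: FinFun.Injective_map_NoDup => // x y [].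
by move=> [i x] /in_map_iff[y [[<- _] _]] /h2; rewrite ltnn.
Qed.

Section TwoSided.
Variables (F : group) (S : F -> Prop).
Hypothesis SF : free_basis F S.
Variables psi phi : F -> F.
Hypothesis hpsi : is_hom F psi.
Hypothesis psiK : forall x, phi (psi x) = x.
Hypothesis phiK : forall x, psi (phi x) = x.

Lemma inverse_hom : is_hom F phi.
Proof. by move=> x y; rewrite -{1}(phiK x) -{1}(phiK y) -hpsi psiK. Qed.
Let hphi := inverse_hom.

Lemma iter_cancel i x : iter i psi (iter i phi x) = x.
Proof. by elim: i x => // i IH x; rewrite iterSr /= phiK IH. Qed.

Lemma iter_cancel_le i k x : (i <= k)%N -> iter k psi (iter i phi x) = iter (k - i) psi x.
Proof. by move=> ik; rewrite -{1}(subnK ik) iterD iter_cancel. Qed.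

Variables (X b c b' d : seq F).
Hypothesis genX : forall g,
  ggen F (fun y => exists i x, In x X /\ (y = iter i psi x \/ y = iter i phi x)) g.
Hypothesis Xb : forall x, In x X -> ggen F (fun g => In g b) x.
Hypothesis psib : forall x, In x b -> ggen F (fun g => In g b \/ In g c) (psi x).
Hypothesis bcV : forall x, In x b \/ In x c -> orbit_gen psi X x.
Hypothesis prV : forall (u : F -> rat) (v : nat -> F -> rat), exists chi,
  [/\ hom_on (orbit_gen psi X) chi, forall x, In x b -> chi x = u x &
      forall i x, In x c -> chi (iter i psi x) = v i x].

Let Y := map phi (b ++ c).
Let E := orbit_gen phi Y.
Hypothesis Yb' : forall x, In x Y -> ggen F (fun g => In g b') x.
Hypothesis phib' : forall x, In x b' -> ggen F (fun g => In g b' \/ In g d) (phi x).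
Hypothesis bdE : forall x, In x b' \/ In x d -> E x.
Hypothesis prE : forall (u : F -> rat) (v : nat -> F -> rat), exists chi,
  [/\ hom_on E chi, forall x, In x b' -> chi x = u x &
      forall i x, In x d -> chi (iter i phi x) = v i x].
Hypotheses (nc : NoDup c) (nd : NoDup d).

Let V := orbit_gen psi X.
Let sE : is_subgroup F E := ggen_subgroup _.

Lemma InY x : In (phi x) Y <-> In x b \/ In x c.
Proof.
rewrite -in_app_iff; split; last exact: in_map.
by move=> /in_map_iff[y [/(congr1 psi)]]; rewrite !phiK => ->.
Qed.

(* [E], generated by the translates of [b] and [c] under the negative powers of [psi],
   is the union of the subgroups generated by the [Egen m] and of those generated by the
   [Tgen n]; the sizes of these generating sets are compared in [same_size]. *)
Definition Tgen n y := In y b' \/ exists i x, (i < n)%N /\ In x d /\ y = iter i phi x.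
Definition Egen m y := (exists x, In x b /\ y = iter m phi x) \/
  exists i x, (i < m)%N /\ In x c /\ y = iter i.+1 phi x.

Lemma Tgen_mono n n' g : (n <= n')%N -> ggen F (Tgen n) g -> ggen F (Tgen n') g.
Proof.
move=> h; apply: ggen_mono => x [|[i [y [i_n [yd ->]]]]]; first by left.
by right; exists i, y; split=> //; lia.
Qed.

Lemma phi_Tgen n g : ggen F (Tgen n) g -> ggen F (Tgen n.+1) (phi g).
Proof.
apply: (ggen_image hphi) => x [/phib'|[i [y [i_n [yd ->]]]]].
  apply: ggen_mono => y [|yd]; [by left|right].
  by exists 0%N, y.
by apply: gen_base; right; exists i.+1, y.
Qed.

Lemma b_T m x : In x b -> ggen F (Tgen m) (iter m.+1 phi x).
Proof.
move=> xb; elim: m => [|m IH]; last exact: phi_Tgen.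
by have /Yb' : In (phi x) Y; [apply/InY; left|apply: ggen_mono => y; left].
Qed.

Lemma c_T m x : In x c -> ggen F (Tgen m) (iter m.+1 phi x).
Proof.
move=> xb; elim: m => [|m IH]; last exact: phi_Tgen.
by have /Yb' : In (phi x) Y; [apply/InY; right|apply: ggen_mono => y; left].
Qed.

Lemma Egen_T m g : ggen F (Egen m.+1) g -> ggen F (Tgen m) g.
Proof.
apply: ggen_sub; first exact: ggen_subgroup.
move=> _ [[x [xb ->]]|[i [x [im [xc ->]]]]]; first exact: b_T.
by apply: Tgen_mono (c_T _ xc).
Qed.

(** For [x] in [b], [x = phi (psi x)] and [psi x] is a word in [b] and [c]; so level [m] is
    contained in level [m.+1]. *)
Lemma Egen_S m g : ggen F (Egen m) g -> ggen F (Egen m.+1) g.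
Proof.
apply: ggen_sub; first exact: ggen_subgroup.
move=> _ [[x [xb ->]]|[i [x [im [xc ->]]]]]; last first.
  by apply: gen_base; right; exists i, x; split=> //; lia.
rewrite -(psiK x) -iterSr; have := psib xb.
apply: (ggen_image (iter_hom hphi m.+1)) => y [yb|yc]; apply: gen_base.
  by left; exists y.
by right; exists m, y.
Qed.

Lemma Egen_mono m m' g : (m <= m')%N -> ggen F (Egen m) g -> ggen F (Egen m') g.
Proof. by move=> /subnK<-; elim: (m' - m)%N => //= k IH /IH; apply: Egen_S. Qed.

Lemma phi_Egen m g : ggen F (Egen m) g -> ggen F (Egen m.+1) (phi g).
Proof.
apply: (ggen_image hphi) => _ [[x [xb ->]]|[i [x [im [xc ->]]]]]; apply: gen_base.
  by left; exists x.
by right; exists i.+1, x.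
Qed.

Lemma E_union g : E g <-> exists m, ggen F (Egen m) g.
Proof.
split.
  elim=> [_ [i [y [/in_map_iff[x [<- /in_app_iff xbc]] ->]]]||x y _ [m hm] _ [m' hm']|x _ [m hm]].
  - exists i.+1; rewrite -iterSr; apply: gen_base.
    by case: xbc => h; [left; exists x|right; exists i, x].
  - by exists 0%N; apply: gen_one.
  - exists (m + m')%N; apply: gen_mul; [apply: Egen_mono hm|apply: Egen_mono hm']; lia.
  - by exists m; apply: gen_inv.
case=> m /Egen_S; apply: ggen_sub => // _ [[x [xb ->]]|[i [x [im [xc ->]]]]];
  rewrite iterSr; apply: gen_base; [exists m|exists i]; exists (phi x); split=> //; apply/InY; auto.
Qed.

(** At level [a] all of [b'] and [d] are present, and [phi] raises the level by one. *)
Lemma T_Egen : exists a, forall n g, ggen F (Tgen n) g -> ggen F (Egen (a + n)) g.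
Proof.
have [a ha] : exists a, forall x, In x (b' ++ d) -> ggen F (Egen a) x.
  have : forall x, In x (b' ++ d) -> E x by move=> x /in_app_iff; apply: bdE.
  elim: (b' ++ d) => [|x s IH] hs; first by exists 0%N.
  have [|a ha] := IH; first by move=> y ys; apply: hs; right.
  have /E_union[m hm] := hs x (or_introl erefl).
  by exists (m + a)%N => y [<-|/ha h]; [apply: Egen_mono hm|apply: Egen_mono h]; lia.
exists a => n; apply: ggen_sub; first exact: ggen_subgroup.
move=> y [yb|[i [x [i_n [xd ->]]]]].
  by apply: (Egen_mono (leq_addr n a)); apply: ha; apply/in_app_iff; left.
apply: (@Egen_mono (a + i)%N); first by lia.
elim: i {i_n} => [|i IH]; first by rewrite addn0; apply: ha; apply/in_app_iff; right.
by rewrite addnS; apply: phi_Egen.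
Qed.

Lemma sub_Egen_V k g : ggen F (Egen k) g -> V (iter k psi g).
Proof.
apply: (ggen_image (iter_hom hpsi k)) => _ [[x [xb ->]]|[i [x [im [xc ->]]]]].
  by rewrite iter_cancel; apply: bcV; left.
by rewrite iter_cancel_le //; apply: (orbit_gen_iter hpsi); apply: bcV; right.
Qed.

Lemma prescribe_shift k (u : F -> rat) (vneg vpos : nat -> F -> rat) : exists chi,
  [/\ hom_on (fun g => V (iter k psi g)) chi,
      forall x, In x b -> chi (iter k phi x) = u x,
      forall i x, (i < k)%N -> In x c -> chi (iter i.+1 phi x) = vneg i x &
      forall i x, In x c -> chi (iter i psi x) = vpos i x].
Proof.
(* A character of [V] is pulled back by [iter k psi], which sends [iter i.+1 phi x] to
   [iter (k - i.+1) psi x]: positions below [k] carry the negative translates in reverse order. *)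
have [chi [h1 h2 h3]] := prV u (fun j x => if (j < k)%N then vneg (k - j.+1)%N x else vpos (j - k)%N x).
exists (fun g => chi (iter k psi g)); split.
- by move=> x y hx hy; rewrite (iter_hom hpsi) h1.
- by move=> x xb; rewrite iter_cancel h2.
- move=> i x ik xc; rewrite iter_cancel_le // h3 //.
  have -> : (k - i.+1 < k)%N by lia.
  by congr (vneg _ _); lia.
- by move=> i x xc; rewrite -iterD h3 // ltnNge leq_addr /= addKn.
Qed.

(** Growth rates are compared; [k = p + q * n + 1] already excludes [n < m]. *)
Lemma size_le_of_linear m n p q : (forall k, k * m <= p + (q + k) * n)%N -> (m <= n)%N.
Proof. by move=> h; have := h (p + q * n).+1; nia. Qed.

(** For every [k], [k] translates of [c] are independent in a subgroup with [size b' + k * size d]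
    generators, and [k] translates of [d] in one with [size b + (a + k) * size c]. *)
Lemma same_size : size c = size d.
Proof.
have [a ha] := T_Egen.
have EE m g : ggen F (Egen m) g -> E g by move=> h; apply/E_union; exists m.
apply/eqP; rewrite eqn_leq; apply/andP; split.
- apply: (@size_le_of_linear _ _ (size b') 0%N) => k.
  pose G := b' ++ map (fun ix => iter ix.1 phi ix.2) (grid k d).
  have GT g : ggen F (fun y => In y G) g <-> ggen F (Tgen k) g.
    split; apply: ggen_mono => y; rewrite in_app_iff in_map_iff.
      by case=> [|[[i x] [<- /In_grid[i_k xd]]]]; [left|right; exists i, x].
    case=> [|[i [x [ik [xd ->]]]]]; [by left|right].
    by exists (i, x); split=> //; apply/In_grid.
  have := @size_independent F _ (fun ix => iter ix.1.+1 phi ix.2) (grid k c) G (NoDup_grid k nc).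
  rewrite size_grid /G size_cat size_map size_grid; apply.
    by move=> [i x] /In_grid[ik xc]; apply/GT; apply: (@Tgen_mono i); [lia|apply: c_T].
  move=> l; have [chi [h1 _ h3 _]] := prescribe_shift (a + k) (fun=> 0) (fun i x => l (i, x)) (fun _ _ => 0).
  exists chi; split.
    by apply: hom_on_sub h1 => g /GT/ha/sub_Egen_V.
  by move=> [i x] /In_grid[ik xc]; apply: h3 => //=; lia.
- apply: (@size_le_of_linear _ _ (size b) a) => k.
  pose G := map (iter (a + k) phi) b ++ map (fun ix => iter ix.1.+1 phi ix.2) (grid (a + k) c).
  have GE g : ggen F (fun y => In y G) g <-> ggen F (Egen (a + k)) g.
    split; apply: ggen_mono => y; rewrite in_app_iff !in_map_iff.
      case=> [[x [<- xb]]|[[i x] [<- /In_grid[i_k xd]]]]; first by left; exists x.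
      by right; exists i, x.
    case=> [[x [xb ->]]|[i [x [ik [xd ->]]]]]; first by left; exists x.
    by right; exists (i, x); split=> //; apply/In_grid.
  have := @size_independent F _ (fun ix => iter ix.1 phi ix.2) (grid k d) G (NoDup_grid k nd).
  rewrite size_grid /G size_cat !size_map size_grid; apply.
    move=> [i x] /In_grid[ik xd]; apply/GE; apply: ha; apply: gen_base; right.
    by exists i, x.
  move=> l; have [chi [h1 _ h3]] := prE (fun=> 0) (fun i x => l (i, x)).
  exists chi; split.
    by apply: hom_on_sub h1 => g /GE/EE.
  by move=> [i x] /In_grid[ik xd]; apply: h3.
Qed.

Definition Ugen n y := E y \/ exists i x, (i < n)%N /\ In x c /\ y = iter i psi x.

Lemma Ugen_mono n n' g : (n <= n')%N -> ggen F (Ugen n) g -> ggen F (Ugen n') g.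
Proof.
move=> h; apply: ggen_mono => x [|[i [y [i_n [yd ->]]]]]; first by left.
by right; exists i, y; split=> //; lia.
Qed.

Lemma b_E x : In x b -> E x.
Proof. by move=> xb; apply/E_union; exists 0%N; apply: gen_base; left; exists x. Qed.

Lemma psi_E g : E g -> ggen F (Ugen 1) (psi g).
Proof.
apply: (ggen_image hpsi) => _ [[|i] [_ [/in_map_iff[x [<- /in_app_iff xbc]] ->]]].
  rewrite /= phiK; apply: gen_base; case: xbc => h; first by left; apply: b_E.
  by right; exists 0%N, x.
rewrite /= phiK; apply: gen_base; left; apply: (orbit_gen_iter hphi).
by apply: gen_base; exists 0%N, (phi x); split=> //; apply/InY.
Qed.

Lemma psi_Ugen n g : ggen F (Ugen n) g -> ggen F (Ugen n.+1) (psi g).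
Proof.
apply: (ggen_image hpsi) => x [/psi_E|[i [y [i_n [yd ->]]]]]; first exact: Ugen_mono.
by apply: gen_base; right; exists i.+1, y.
Qed.

Lemma iter_psi_E n g : E g -> ggen F (Ugen n) (iter n psi g).
Proof.
by move=> Eg; elim: n => [|n IH]; [apply: gen_base; left|apply: psi_Ugen].
Qed.

(** [X] lies in [E], which [phi] preserves, and [psi] raises the level by one; so each translate of
    [X] occurs at some level. *)
Lemma Ugen_union (R : F -> Prop) : is_subgroup F R -> (forall n x, ggen F (Ugen n) x -> R x) ->
  forall g, R g.
Proof.
move=> sR hR g; move: (genX g).
suff h i x : In x X -> (exists n, ggen F (Ugen n) (iter i psi x)) /\
    exists n, ggen F (Ugen n) (iter i phi x).
  apply: ggen_sub => // y [i [x [xX [->|->]]]]; have [[n1 h1] [n2 h2]] := h i x xX.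
    exact: hR h1.
  exact: hR h2.
move=> xX; have Ex : E x.
  by have := Xb xX; apply: ggen_sub => // y; apply: b_E.
split; first by exists i; apply: iter_psi_E.
by exists 0%N; apply: gen_base; left; apply: (orbit_gen_iter hphi).
Qed.

(** A relation involves finitely many elements of [E], all at some level [k]. There a shifted
    character of [V] agrees with [chiE] and takes the values [nu], so the relation is killed. *)
Lemma extend_E (chiE : F -> rat) (nu : nat -> F -> rat) : hom_on E chiE -> exists chi,
  [/\ total_hom chi, forall g, E g -> chi g = chiE g &
      forall i x, In x c -> chi (iter i psi x) = nu i x].
Proof.
move=> hE.
pose z (i : F + nat * F) := match i with inl g => g | inr (i, x) => iter i psi x end.
pose P (i : F + nat * F) := match i with inl g => E g | inr (i, x) => In x c end.
pose l (i : F + nat * F) := match i with inl g => chiE g | inr (i, x) => nu i x end.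
have [|chi [hchi chiz]] := @hom_of_relations F _ z P l.
  move=> w hw Ew.
  have [k hk] : exists k, letters_in (fun i =>
      match i with inl g => ggen F (Egen k) g | inr (i, x) => In x c end) w.
    elim: w hw {Ew} => [|[i e] w IH] hw; first by exists 0%N.
    have [|k hk] := IH; first by move=> a ha; apply: hw; right.
    have : P i := hw (i, e) (or_introl erefl).
    case: i {hw} => [g /E_union[m hm]|[i x] xc].
      exists (m + k)%N => a [<- /=|/hk]; first by apply: Egen_mono hm; lia.
      by case: a.1 => [g'|[]//]; apply: Egen_mono; lia.
    by exists k => a [<-|/hk].
  have [chi [h1 h2 h3 h4]] := prescribe_shift k (fun x => chiE (iter k phi x))
     (fun i x => chiE (iter i.+1 phi x)) nu.
  have kE g : ggen F (Egen k) g -> chi g = chiE g.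
    apply: hom_on_ext.
    - by apply: hom_on_sub h1 => x /sub_Egen_V.
    - by apply: hom_on_sub hE => x hx; apply/E_union; exists k.
    - by move=> _ [[x [xb ->]]|[i [x [ik [xc ->]]]]]; [apply: h2|apply: h3].
  have sV : is_subgroup F (fun g => V (iter k psi g)).
    have [V1 [VM VV]] : is_subgroup F V := ggen_subgroup _.
    split; first by rewrite (hom1 (iter_hom hpsi k)).
    split=> [x y hx hy|x hx]; first by rewrite (iter_hom hpsi); apply: VM.
    by rewrite (homV (iter_hom hpsi k)); apply: VV.
  rewrite -(hom_on1 sV h1) -Ew; symmetry; apply: wsum_hom hk _.
    apply: hom_on_sub h1; apply: ggen_sub => // _ [[g|[i x]] [hi ->]] /=.
      exact: sub_Egen_V.
    by rewrite -iterD; apply: (orbit_gen_iter hpsi); apply: bcV; right.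
  by move=> [g|[i x]]; [apply: kE|apply: h4].
have all g : ggen F (fun y => exists i, P i /\ y = z i) g.
  apply: Ugen_union; first exact: ggen_subgroup.
  move=> n x; apply: ggen_mono => y [Ey|[i [x' [_ [xc ->]]]]].
    by exists (inl y).
  by exists (inr (i, x')).
exists chi; split.
- by move=> x y _ _; apply: hchi.
- by move=> g Eg; apply: (chiz (inl g)).
- by move=> i x xc; apply: (chiz (inr (i, x))).
Qed.

Let cj j := nth one c j.
Let dj j := nth one d j.

Lemma cj_In j : (j < size c)%N -> In (cj j) c.
Proof. by move=> jc; apply/(In_nth one); exists j. Qed.

Lemma dj_In j : (j < size c)%N -> In (dj j) d.
Proof. by rewrite same_size => jd; apply/(In_nth one); exists j. Qed.

(* Modulo what is already generated, the translate of [twisted j] by [psi^i] is that of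
   [c_j] for [i >= 0] and that of [d_j] for [i < 0]. *)
Definition twisted j := cj j ** dj j.

Lemma T_E n g : ggen F (Tgen n) g -> E g.
Proof. by have [a ha] := T_Egen => /ha h; apply/E_union; exists (a + n)%N. Qed.

Lemma cj_E i j : (j < size c)%N -> E (iter i.+1 phi (cj j)).
Proof. by move=> jc; apply: (@T_E i); apply: c_T; apply: cj_In. Qed.

Lemma dj_E i j : (j < size c)%N -> E (iter i phi (dj j)).
Proof. by move=> jc; apply: (orbit_gen_iter hphi); apply: bdE; right; apply: dj_In. Qed.

Lemma twisted_E i j : (j < size c)%N -> E (iter i.+1 phi (twisted j)).
Proof.
by move=> jc; rewrite (iter_hom hphi); apply: (proj1 (proj2 sE)); [apply: cj_E|apply: dj_E].
Qed.

(** Triangular induction: a character [eta] that vanishes on the group of [Tgen n.+1] and is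
    arbitrary on [iter n.+1 phi] of [d] corrects the values at level [n.+1]. The [c] factor there
    and everything prescribed before lie in that group. *)
Lemma prescribe_negative n (u : F -> rat) (v : nat -> nat -> rat) : exists chi,
  [/\ hom_on E chi, forall x, In x b' \/ In x d -> chi x = u x &
      forall i j, (0 < i <= n)%N -> (j < size c)%N -> chi (iter i phi (twisted j)) = v i j].
Proof.
have [rk hrk] := NoDup_rank one nd.
elim: n => [|n [chi [h1 h2 h3]]].
  have [chi [h1 h2 h3]] := prE u (fun _ => u).
  exists chi; split=> // [x [/h2//|xd]|i j]; last by lia.
  exact: (h3 0%N).
have [eta [g1 g2 g3]] := prE (fun=> 0) (fun i x =>
  if i == n.+1 then v n.+1 (rk x) - chi (iter n.+1 phi (twisted (rk x))) else 0).
have gT g : ggen F (Tgen n.+1) g -> eta g = 0.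
  apply: (@hom_on_ext _ _ eta (fun=> 0)).
  - by apply: hom_on_sub g1 => x; apply: T_E.
  - by move=> x y _ _; rewrite addr0.
  - move=> x [/g2//|[i [y [i_n [yd ->]]]]]; rewrite g3 //.
    by case: eqP i_n => // ->; rewrite ltnn.
have eta_tw i j : (i <= n)%N -> (j < size c)%N ->
    eta (iter i.+1 phi (twisted j)) = eta (iter i.+1 phi (dj j)).
  move=> i_n jc; rewrite (iter_hom hphi) g1; [|exact: cj_E|exact: dj_E].
  rewrite gT ?add0r //; apply: (@Tgen_mono i); first by lia.
  by apply: c_T; apply: cj_In.
exists (fun g => chi g + eta g); split.
- by move=> x y Ex Ey; rewrite h1 // g1 // addrACA.
- move=> x xbd; rewrite h2 // gT ?addr0 //; apply: gen_base.
  by case: xbd => h; [left|right; exists 0%N, x].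
- move=> [|i] j // /andP[_]; rewrite ltnS leq_eqVlt => /orP[/eqP->|i_n] jc.
    rewrite eta_tw // g3 ?eqxx; last exact: dj_In.
    by rewrite hrk -?same_size // addrC subrK.
  rewrite h3 // (eta_tw _ _ (ltnW i_n) jc) g3; last exact: dj_In.
  by rewrite eqSS ltn_eqF // addr0.
Qed.

(** The same correction in the positive direction: the translate of [c] is now the new generator,
    and that of [d] lies in the group of [Ugen k]. *)
Lemma prescribe_window n (u : F -> rat) (v w : nat -> nat -> rat) : exists chi,
  [/\ total_hom chi, forall x, In x b' \/ In x d -> chi x = u x,
      forall i j, (0 < i <= n)%N -> (j < size c)%N -> chi (iter i phi (twisted j)) = v i j &
      forall i j, (i < n)%N -> (j < size c)%N -> chi (iter i psi (twisted j)) = w i j].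
Proof.
have [rk hrk] := NoDup_rank one nc.
suff h k : exists chi,
    [/\ total_hom chi, forall x, In x b' \/ In x d -> chi x = u x,
      forall i j, (0 < i <= n)%N -> (j < size c)%N -> chi (iter i phi (twisted j)) = v i j &
      forall i j, (i < k)%N -> (j < size c)%N -> chi (iter i psi (twisted j)) = w i j] by apply: h.
elim: k => [|k [chi [h1 h2 h3 h4]]].
  have [chiE [e1 e2 e3]] := prescribe_negative n u v.
  have [chi [h1 h2 h3]] := extend_E (fun _ _ => 0) e1.
  exists chi; split=> // [x xbd|[|i] j // hi jc].
    by rewrite h2 ?e2 //; apply: bdE.
  by rewrite h2 ?e3 //; apply: twisted_E.
have [|eta [g1 g2 g3]] := @extend_E (fun=> 0) (fun i x =>
  if i == k then w k (rk x) - chi (iter k psi (twisted (rk x))) else 0).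
  by move=> x y _ _; rewrite addr0.
have gU g : ggen F (Ugen k) g -> eta g = 0.
  apply: (@hom_on_ext _ _ eta (fun=> 0)).
  - by apply: hom_on_sub g1.
  - by move=> x y _ _; rewrite addr0.
  - move=> x [/g2//|[i [y [i_n [yd ->]]]]]; rewrite g3 //.
    by case: eqP i_n => // ->; rewrite ltnn.
have eta_tw i j : (i <= k)%N -> (j < size c)%N ->
    eta (iter i psi (twisted j)) = eta (iter i psi (cj j)).
  move=> ik jc; rewrite (iter_hom hpsi) g1 // (gU (iter i psi (dj j))) ?addr0 //.
  apply: (Ugen_mono ik); apply: iter_psi_E; apply: bdE; right; exact: dj_In.
exists (fun g => chi g + eta g); split.
- by move=> x y _ _; rewrite h1 // g1 // addrACA.
- by move=> x xbd; rewrite h2 // g2 ?addr0 //; apply: bdE.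
- move=> [|i] j // hi jc; rewrite h3 // g2 ?addr0 //; exact: twisted_E.
- move=> i j; rewrite ltnS leq_eqVlt => /orP[/eqP->|ik] jc.
    rewrite eta_tw // g3 ?eqxx; last exact: cj_In.
    by rewrite hrk // addrC subrK.
  rewrite h4 // (eta_tw _ _ (ltnW ik) jc) g3; last exact: cj_In.
  by rewrite ltn_eqF // addr0.
Qed.

(** By induction on the level, dividing a translate of [twisted j] by the factor already in [R]
    recovers the other one: that of [d] under [phi], that of [c] under [psi]. *)
Lemma twisted_generate (R : F -> Prop) : is_subgroup F R ->
  (forall x, In x b' \/ In x d -> R x) ->
  (forall i j, (j < size c)%N -> R (iter i phi (twisted j)) /\ R (iter i psi (twisted j))) ->
  forall g, R g.
Proof.
move=> sR Rbd Rt; have [R1 [RM RV]] := sR.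
have RT n g : ggen F (Tgen n) g -> R g.
  elim: n g => [|n IH]; apply: ggen_sub => // x [xb|[i [y [i_n [yd ->]]]]] //;
    try by apply: Rbd; left.
  move: i_n; rewrite ltnS leq_eqVlt => /orP[/eqP->|i_n]; last first.
    by apply: IH; apply: gen_base; right; exists i, y.
  case: n IH {i} => [|n] IH; first by apply: Rbd; right.
  have /(In_nth one)[j [jd ->]] := yd; rewrite -same_size in jd.
  apply: (subgroup_mull sR (x := iter n.+1 phi (cj j))).
    by apply: IH; apply: (@Tgen_mono n) => //; apply: c_T; apply: cj_In.
  by rewrite -(iter_hom hphi); have [] := Rt n.+1 j jd.
have RE g : E g -> R g by move=> /E_union[m /Egen_S/Egen_T/RT].
apply: Ugen_union => // n; elim: n => [|n IH] x; apply: ggen_sub => // y [/RE//|[i [y' [i_n [yc ->]]]]] //.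
move: i_n; rewrite ltnS leq_eqVlt => /orP[/eqP->|i_n]; last first.
  by apply: IH; apply: gen_base; right; exists i, y'.
have /(In_nth one)[j [jc ->]] := yc.
apply: (subgroup_mulr sR (y := iter n psi (dj j))).
  by apply: IH; apply: iter_psi_E; apply: bdE; right; apply: dj_In.
by rewrite -(iter_hom hpsi); have [] := Rt n j jc.
Qed.

End TwoSided.

(** * Free product decompositions and the semidirect product *)

Section NormalForm.
Variables (F : group) (I : Type) (z : I -> F).

Definition syllable (K : I -> Prop) (a : I * F) :=
  [/\ K a.1, ggen F (eq (z a.1)) a.2 & a.2 <> one].

Lemma gprod_cat (s1 s2 : seq F) : gprod F (s1 ++ s2) = gprod F s1 ** gprod F s2.
Proof. by elim: s1 => [|x s IH] /=; rewrite ?gmul1l // -gmulA -IH. Qed.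

Lemma syllable_normal_form (K : I -> Prop) h :
  ggen F (fun y => exists i, K i /\ y = z i) h ->
  exists s : seq (I * F), [/\ alternating s, forall a, In a s -> syllable K a &
    gprod F (map snd s) = h].
Proof.
move=> /ggen_word[w [hw <-]]; elim: w hw => [|[i e] w IH] hw; first by exists [::].
have [|s [als hs Es]] := IH; first by move=> a ha; apply: hw; right.
have Ki : K i by apply: (hw (i, e)); left.
pose x := if e then inv (z i) else z i.
have -> : wval z ((i, e) :: w) = x ** gprod F (map snd s) by rewrite Es.
clear Es.
have xi : ggen F (eq (z i)) x by rewrite /x; case: (e); [apply: gen_inv|]; apply: gen_base.
case: (classic (x = one)) => [E|x1]; first by exists s; rewrite E gmul1l.
case: s als hs => [|[i' g] s] als hs.
  by exists [:: (i, x)]; split=> // a [<-|//].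
case: (classic (i = i')) => [E|ii']; last first.
  by exists [:: (i, x), (i', g) & s]; split=> // a [<-|/hs].
case: als => hd als; have [_ /= gi' _] := hs (i', g) (or_introl erefl).
case: (classic (x ** g = one)) => [E1|n1].
  exists s; split=> //; first by move=> a ha; apply: hs; right.
  change (gprod F (map snd s) = x ** (g ** gprod F (map snd s))).
  by rewrite gmulA E1 gmul1l.
exists ((i, x ** g) :: s); split.
- by split=> //; case: (s) hd => // b s'; rewrite E.
- move=> a [<-|ha]; last by apply: hs; right.
  by split=> //=; apply: gen_mul => //; rewrite E.
- by rewrite /= -gmulA.
Qed.

(** Each factor is expanded into syllables; at a junction the indices differ since they lie in
    different parts. The clause on the head of [s] carries this through the induction. *)
Lemma alternating_refine (T : Type) (K : I -> Prop) (part : I -> T) (l : seq (T * F)) :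
  alternating l ->
  (forall a, In a l -> a.2 <> one /\
     ggen F (fun y => exists i, (K i /\ part i = a.1) /\ y = z i) a.2) ->
  exists s : seq (I * F), [/\ alternating s, forall a, In a s -> syllable K a,
    gprod F (map snd s) = gprod F (map snd l) &
    if l is a :: _ then exists b s', s = b :: s' /\ part b.1 = a.1 else s = [::]].
Proof.
elim: l => [|[t h] l IH] /=; first by exists [::].
move=> [hd al] hl; have [|s1 [al1 hs1 E1 hd1]] := IH al.
  by move=> a ha; apply: hl; right.
have [h1 /syllable_normal_form[s0 [al0 hs0 E0]]] := hl _ (or_introl erefl).
rewrite /= in h1 E0.
exists (s0 ++ s1); split.
- have parts a : In a s0 -> part a.1 = t by move=> /hs0[[]].
  have {}hd1 b s' : s1 = b :: s' -> part b.1 <> t.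
    case: l {IH al hl E1} hd hd1 => [_ -> //|[t' h'] l /= tt' [b1 [s1' [-> Eb]]] [<- _]].
    by rewrite Eb => E; apply: tt'.
  elim: (s0) al0 parts => [|a [|b s] IHs] //= [ha als] parts.
    split=> //; case: (s1) hd1 => // b s' hb E; apply: (hb b s') => //.
    by rewrite -E; apply: parts; left.
  by split=> //; apply: IHs => // a' ha'; apply: parts; right.
- move=> a /in_app_iff[/hs0[[? _] ? ?]|/hs1] //.
- by rewrite map_cat gprod_cat E0 E1.
- case: s0 {al0} hs0 E0 => [|b s] hs0 E0; first by case: h1; rewrite -E0.
  by exists b, (s ++ s1); split=> //; have [[]] := hs0 b (or_introl erefl).
Qed.
End NormalForm.

(** [one_sided] is applied to [psi] and [X], then to [phi] and the [phi]-images of [b] and [c].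
    Duplicates are removed from [c] and [d] for the rank count. *)
Lemma two_sided (F : group) (S : F -> Prop) (psi phi : F -> F) (X : seq F) :
  free_basis F S -> is_hom F psi ->
  (forall x, phi (psi x) = x) -> (forall x, psi (phi x) = x) ->
  (forall g, ggen F (fun y => exists i x, In x X /\ (y = iter i psi x \/ y = iter i phi x)) g) ->
  exists (a : seq F) (r : nat) (e : nat -> F),
    (forall n (u : F -> rat) (v w : nat -> nat -> rat), exists chi,
      [/\ total_hom chi, forall x, In x a -> chi x = u x,
       forall i j, (0 < i <= n)%N -> (j < r)%N -> chi (iter i phi (e j)) = v i j &
       forall i j, (i < n)%N -> (j < r)%N -> chi (iter i psi (e j)) = w i j]) /\
    (forall R : F -> Prop, is_subgroup F R -> (forall x, In x a -> R x) ->
      (forall i j, (j < r)%N -> R (iter i phi (e j)) /\ R (iter i psi (e j))) ->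
      forall g, R g).
Proof.
move=> SF hpsi psiK phiK genX.
have hphi := inverse_hom hpsi psiK phiK.
have [b [c0 [Xb psib bcV prV]]] := one_sided SF hpsi X.
have [c [nc hc]] := NoDup_same c0.
have [b' [d0 [Yb' phib' bdE prE]]] := one_sided SF hphi (map phi (b ++ c)).
have [d [nd hd]] := NoDup_same d0.
have psib1 x : In x b -> ggen F (fun g => In g b \/ In g c) (psi x).
  by move/psib; apply: ggen_mono => y; rewrite hc.
have bcV1 x : In x b \/ In x c -> orbit_gen psi X x by rewrite hc; apply: bcV.
have prV1 (u : F -> rat) (v : nat -> F -> rat) : exists chi,
    [/\ hom_on (orbit_gen psi X) chi, forall x, In x b -> chi x = u x &
      forall i x, In x c -> chi (iter i psi x) = v i x].
  by have [chi [? ? h]] := prV u v; exists chi; split=> // i x /hc; apply: h.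
have phib1 x : In x b' -> ggen F (fun g => In g b' \/ In g d) (phi x).
  by move/phib'; apply: ggen_mono => y; rewrite hd.
have bdE1 x : In x b' \/ In x d -> orbit_gen phi (map phi (b ++ c)) x.
  by rewrite hd; apply: bdE.
have prE1 (u : F -> rat) (v : nat -> F -> rat) : exists chi,
    [/\ hom_on (orbit_gen phi (map phi (b ++ c))) chi, forall x, In x b' -> chi x = u x &
      forall i x, In x d -> chi (iter i phi x) = v i x].
  by have [chi [? ? h]] := prE u v; exists chi; split=> // i x /hd; apply: h.
exists (b' ++ d), (size c), (twisted c d); split.
- move=> n u v w.
  have [chi [h1 h2 h3 h4]] := @prescribe_window F psi phi hpsi psiK phiK X b c b' d
    genX Xb psib1 bcV1 prV1 Yb' phib1 bdE1 prE1 nc nd n u v w.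
  by exists chi; split=> // x /in_app_iff; apply: h2.
- move=> R sR hR hR'; apply: (@twisted_generate F psi phi hpsi psiK phiK X b c b' d) => //.
  by move=> x xbd; apply: hR; apply/in_app_iff.
Qed.

(** * Finite generation of the semidirect product *)

Section SemidirectProduct.
Variables (F : group) (psi psiinv : F -> F).
Hypothesis hpsi : is_hom F psi.
Hypothesis phiK : forall x, psi (psiinv x) = x.
Hypothesis psiK : forall x, psiinv (psi x) = x.

Lemma aut_pow_hom i : is_hom F (aut_pow psi psiinv i).
Proof.
have h (f : F -> F) n : is_hom F f -> is_hom F (Nat.iter n f).
  by move=> hf x y; elim: n => //= n ->; rewrite hf.
case: i => [|p|p] //=; [exact: h|apply: h; exact: inverse_hom hpsi psiK phiK].
Qed.

Lemma aut_pow_nat n x : aut_pow psi psiinv (Z.of_nat n) x = iter n psi x.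
Proof. by case: n => // n; rewrite [aut_pow _ _ _]/= SuccNat2Pos.id_succ. Qed.

Lemma aut_pow_opp n x : aut_pow psi psiinv (Z.opp (Z.of_nat n)) x = iter n psiinv x.
Proof. by case: n => // n; rewrite [aut_pow _ _ _]/= SuccNat2Pos.id_succ. Qed.

Lemma Z_nat_cases (i : Z) :
  (exists n, i = Z.of_nat n) \/ exists n, (0 < n)%N /\ i = Z.opp (Z.of_nat n).
Proof.
case: i => [|p|p]; [by left; exists 0%N|left|right]; exists (Pos.to_nat p); last split.
- by rewrite positive_nat_Z.
- by apply/ltP; apply: Pos2Nat.is_pos.
- by rewrite positive_nat_Z.
Qed.

Definition decomposition := exists (A C0 : F -> Prop),
    fg_subgroup F A /\ fg_subgroup F C0 /\
    free_product_decomp F (option Z)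
      (fun j => match j with
                | None => A
                | Some i => img (aut_pow psi psiinv i) C0
                end).

Lemma aut_pow_invariant (R : F -> Prop) : (forall x, R x -> R (psi x)) ->
  (forall x, R x -> R (psiinv x)) -> forall i x, R x -> R (aut_pow psi psiinv i x).
Proof.
move=> h h' i x; have [[n ->]|[n [_ ->]]] := Z_nat_cases i;
  rewrite ?aut_pow_nat ?aut_pow_opp; elim: n => //= n IH /IH; [exact: h|exact: h'].
Qed.

(** The subgroup generated by the translates of the first coordinates is invariant under [psi] and
    [psiinv], hence contains the first coordinate of every product and inverse. *)
Lemma semidirect_fg_orbit : semidirect_fg F psi psiinv -> exists X : seq F, forall g,
  ggen F (fun y => exists i x, In x X /\ (y = iter i psi x \/ y = iter i psiinv x)) g.
Proof.
case=> l hl; exists (map fst l) => g; set W := ggen F _.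
have [W1 [WM WV]] : is_subgroup F W := ggen_subgroup _.
have Winv : forall i x, W x -> W (aut_pow psi psiinv i x).
  apply: aut_pow_invariant => x.
    apply: (ggen_image hpsi) => _ [i [y [yX [->|->]]]].
      by apply: gen_base; exists i.+1, y; split=> //; left.
    case: i => [|i]; apply: gen_base; first by exists 1%N, y; split=> //; left.
    by exists i, y; split=> //; right; rewrite /= phiK.
  apply: (ggen_image (inverse_hom hpsi psiK phiK)) => _ [i [y [yX [->|->]]]]; last first.
    by apply: gen_base; exists i.+1, y; split=> //; right.
  case: i => [|i]; apply: gen_base; first by exists 1%N, y; split=> //; right.
  by exists i, y; split=> //; left; rewrite /= psiK.
suff h p : gen (sd_mul F psi psiinv) (sd_inv F psi psiinv) (sd_one F) (fun y => In y l) p -> W p.1.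
  exact: h (g, Z0) (hl _).
elim=> {p} [p pl||p q _ hp _ hq|p _ hp] //=.
- by apply: gen_base; exists 0%N, p.1; split; [apply: in_map|left].
- by apply: WM => //; apply: Winv.
- by apply: Winv; apply: WV.
Qed.

(** The generators of [F] are indexed by [F + Z * nat], elements of [a] on the left and translates
    of [e] on the right, and [part] names the free factor of each. Alternating products are refined
    to syllables in these generators. *)
Lemma decomposition_of_fg : is_free_group F -> semidirect_fg F psi psiinv -> decomposition.
Proof.
move=> [S SF] /semidirect_fg_orbit[X genX].
have [a [r [e [pr gen]]]] := two_sided SF hpsi psiK phiK genX.
pose z (i : F + Z * nat) : F :=
  match i with inl x => x | inr (k, j) => aut_pow psi psiinv k (e j) end.
pose K (i : F + Z * nat) := match i with inl x => In x a | inr (_, j) => (j < r)%N end.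
pose part (i : F + Z * nat) : option Z := match i with inl _ => None | inr (k, _) => Some k end.
pose C0 := ggen F (fun y => In y (map e (iota 0 r))).
have C0e y : In y (map e (iota 0 r)) <-> exists j, (j < r)%N /\ y = e j.
  by rewrite in_map_iff; split=> [[j [<- /In_iota hj]]|[j [jr ->]]]; exists j; split=> //; apply/In_iota.
exists (ggen F (fun y => In y a)), C0; split; first by exists a.
split; first by exists (map e (iota 0 r)).
set H := fun j => _.
have HK j h : H j h -> ggen F (fun y => exists i, (K i /\ part i = j) /\ y = z i) h.
  case: j => [k [g [hg ->]]|]; last first.
    by apply: ggen_mono => y ya; exists (inl y).
  apply: (ggen_image (aut_pow_hom k)) hg => y /C0e[j [jr ->]]; apply: gen_base.
  by exists (inr (k, j)).
split; [|split].
- case=> [k|]; last exact: ggen_subgroup.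
  have [h1 [hM hV]] : is_subgroup F C0 := ggen_subgroup _.
  split; first by exists one; rewrite (hom1 (aut_pow_hom k)).
  split=> [x y [x' [hx ->]] [y' [hy ->]]|x [x' [hx ->]]].
    by exists (x' ** y'); rewrite (aut_pow_hom k); split=> //; apply: hM.
  by exists (inv x'); rewrite (homV (aut_pow_hom k)); split=> //; apply: hV.
- apply: gen; first exact: ggen_subgroup.
    by move=> x xa; apply: gen_base; exists None; apply: gen_base.
  have He k j : (j < r)%N -> ggen F (fun y => exists j, H j y) (aut_pow psi psiinv k (e j)).
    move=> jr; apply: gen_base; exists (Some k), (e j); split=> //.
    by apply: gen_base; apply/C0e; exists j.
  by move=> i j jr; split; rewrite -?aut_pow_opp -?aut_pow_nat; apply: He.
- move=> l l0 /Forall_forall hl al.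
  have [|s [als hs <- hd]] := @alternating_refine F _ z (option Z) K part l al.
    by move=> x /hl[/HK hx x1]; split.
  have s0 : s <> [::] by case: (l) l0 hd => // x l' _ [b [s' [-> _]]].
  (* Only finitely many generators occur in the product, so prescribing values in a window of
     translates suffices. *)
  have [n hn] : exists n, forall i, In i (map fst s) -> K i /\
      match i with inl _ => True | inr (k, _) =>
        (Z.lt (Z.opp (Z.of_nat n)) k /\ Z.lt k (Z.of_nat n)) end.
    elim: (s) hs => [|x s' IH] hs; first by exists 0%N.
    have [|n hn] := IH; first by move=> y ys; apply: hs; right.
    have [Kx _ _] := hs x (or_introl erefl).
    exists (n + (if x.1 is inr (k, _) then (Z.to_nat (Z.abs k)).+1 else 0))%N => i /= [<-|/hn[Ki hi]].
      by split=> //; case: x.1 => // -[k j]; lia.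
    by split=> //; case: i hi {Ki} => // -[k j]; case: x.1 => [?|[k' j']]; lia.
  apply: (@alternating_neq1 F S SF _ z (fun i => In i (map fst s))) => //; last first.
    by move=> x xs; have [_ h1 h2] := hs x xs; split=> //; apply: in_map.
  move=> f; have [chi [h1 h2 h3 h4]] := pr n (fun x => f (inl x))
    (fun i j => f (inr (Z.opp (Z.of_nat i), j))) (fun i j => f (inr (Z.of_nat i, j))).
  exists chi; split=> // -[x|[k j]] /hn[/= Ki hi]; first exact: h2.
  have [[i Ek]|[i [i0 Ek]]] := Z_nat_cases k; rewrite Ek ?aut_pow_nat ?aut_pow_opp.
    by apply: h4 => //; lia.
  by apply: h3 => //; lia.
Qed.

(** Conjugation by [t] realizes [psi], so [t] with the generators of [A] and [C0] reaches every
    translate of [C0]. *)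
Lemma fg_of_decomposition : decomposition -> semidirect_fg F psi psiinv.
Proof.
move=> [A [C0 [[lA hA] [[lC hC] [_ [gen _]]]]]].
pose t : F * Z := (one, Zpos xH).
pose l := t :: map (fun x => (x, Z0)) (lA ++ lC).
exists l; set G := Defs.gen _ _ _ _.
have a1 k : aut_pow psi psiinv k one = one := hom1 (aut_pow_hom k).
have Gt : G t by apply: gen_base; left.
have GtV : G (one, Zneg xH).
  by have := gen_inv _ _ _ _ _ Gt; rewrite /sd_inv ginv1 a1.
have Gl x : In x (lA ++ lC) -> G (x, Z0).
  by move=> h; apply: gen_base; right; apply: (in_map (fun x => (x, Z0))).
have sG : is_subgroup F (fun x => G (x, Z0)).
  split; first exact: gen_one.
  by split=> [x y hx hy|x hx]; [exact: (gen_mul _ _ _ _ _ _ hx hy)|exact: (gen_inv _ _ _ _ _ hx)].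
have Gpsi x : G (x, Z0) -> G (psi x, Z0).
  move=> hx; have := gen_mul _ _ _ _ _ _ (gen_mul _ _ _ _ _ _ GtV hx) Gt.
  by rewrite /sd_mul /= gmul1l (hom1 hpsi) gmul1r.
have Gphi x : G (x, Z0) -> G (psiinv x, Z0).
  move=> hx; have := gen_mul _ _ _ _ _ _ (gen_mul _ _ _ _ _ _ Gt hx) GtV.
  by rewrite /sd_mul /= gmul1l (hom1 (inverse_hom hpsi psiK phiK)) gmul1r.
have GF x : G (x, Z0).
  move: (gen x); apply: (@ggen_sub F _ (fun x => G (x, Z0))) => // y [[k [y' [/hC hy ->]]|/hA hy]]; last first.
    by apply: (@ggen_sub F _ (fun x => G (x, Z0)) sG _ _ hy) => w wA; apply: Gl; apply/in_app_iff; left.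
  apply: (@aut_pow_invariant (fun x => G (x, Z0)) Gpsi Gphi k y').
  by apply: (@ggen_sub F _ (fun x => G (x, Z0)) sG _ _ hy) => w wC; apply: Gl; apply/in_app_iff; right.
have GZ m : G (one, m).
  elim/Z.peano_ind: m => [|m hm|m hm]; first exact: gen_one.
    by have := gen_mul _ _ _ _ _ _ hm Gt; rewrite /sd_mul /= a1 gmul1l.
  by have := gen_mul _ _ _ _ _ _ hm GtV; rewrite /sd_mul /= a1 gmul1l.
move=> [x m]; have := gen_mul _ _ _ _ _ _ (GF x) (GZ m).
by rewrite /sd_mul /= gmul1r.
Qed.
End SemidirectProduct.

Theorem theorem1p1 (F : group) (psi psiinv : F -> F)
  (Hfree : is_free_group F)
  (Hhom : is_hom F psi)
  (Hinv1 : forall x, psi (psiinv x) = x)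
  (Hinv2 : forall x, psiinv (psi x) = x) :
  semidirect_fg F psi psiinv <->
  exists (A C0 : F -> Prop),
    fg_subgroup F A /\ fg_subgroup F C0 /\
    free_product_decomp F (option Z)
      (fun j => match j with
                | None => A
                | Some i => img (aut_pow psi psiinv i) C0
                end).
Proof.
split; [exact: decomposition_of_fg|exact: fg_of_decomposition].
Qed.
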